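(* Let $K$ be a field. Let $K[Y]$ be a polynomial ring such that $\mathfrak S_\infty$ acts on the variable set $Y$ (and hence on $K[Y]$ by $K$-algebra automorphisms), such that $K[Y]$ is $\mathfrak S_\infty$-finitely generated as a $K$-algebra (equivalently, $Y$ consists of finitely many $\mathfrak S_\infty$-orbits) and has the finite width property. Let $\ell\ge 1$, let $X=\{x_{i,j}\mid i\in[\ell],\ j\in\mathbb N\}$ with $\mathfrak S_\infty$ acting by $\sigma x_{i,j}=x_{i,\sigma(j)}$, and let $\phi:K[Y]\to K[X]$ be an $\mathfrak S_\infty$-equivariant monomial map. Then there exist an $\operatorname{Inc}(\mathbb N)$-respecting monomial order $\leq$ on $K[Y]$, constructed from $\phi$ in the way described in the context, and a finite set $H\subseteq\ker\phi$ such that $H$ is an $\operatorname{Inc}(\mathbb N)$-equivariant Gröbner basis of $\ker\phi$ with respect to $\leq$.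
   Context: $\mathbb N=\{1,2,3,\dots\}$, $[n]=\{1,\dots,n\}$. $\mathfrak S_\infty=\bigcup_n\mathfrak S_n$ is the group of permutations of $\mathbb N$ fixing all but finitely many elements. $\operatorname{Inc}(\mathbb N)$ is the monoid of strictly increasing functions $\mathbb N\to\mathbb N$. For a set of variables $V$, $[V]$ is the free abelian monoid of monomials in $V$. A monomial map between polynomial rings is a $K$-algebra homomorphism sending each variable to a monomial. A $K$-algebra with $\mathfrak S_\infty$-action is $\mathfrak S_\infty$-finitely generated if it is generated as an algebra by the $\mathfrak S_\infty$-orbits of finitely many elements. Width: for a $K$-algebra $R$ with $\mathfrak S_\infty$-action and $f\in R$, $w(f)$ is the smallest integer $n\geq 0$ such that every $\sigma\in\mathfrak S_\infty$ fixing each of $1,\dots,n$ fixes $f$ ($w(f)=\infty$ if there is none). $R$ has the finite width property if $w(f)<\infty$ for all $f$. In that case $\operatorname{Inc}(\mathbb N)$ acts on $R$ by $\rho f=\sigma f$ for any $\sigma\in\mathfrak S_\infty$ with $\sigma|_{[w(f)]}=\rho|_{[w(f)]}$ (well defined). Monomial orders: for an abelian monoid $M$ with monoid algebra $KM$ (for example $M=[Y]$, $KM=K[Y]$), a monomial order is a total well-order $\leq$ on $M$ such that $a\leq b$ implies $ac\leq bc$; if a monoid $\Pi$ acts on $M$ by monoid homomorphisms, it is $\Pi$-respecting if $a\leq b$ implies $\sigma a\leq\sigma b$ for all $\sigma\in\Pi$. $\operatorname{in}_\leq f$ denotes the initial monomial of $f\ne 0$, and $\operatorname{in}_\leq I$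 the ideal generated by the initial monomials of the nonzero elements of $I$. For a $\Pi$-invariant ideal $I$, a set $G\subseteq I$ is a $\Pi$-equivariant Gröbner basis of $I$ if the set $\Pi G$ of all $\sigma g$ ($\sigma\in\Pi$, $g\in G$) is a Gröbner basis of $I$, i.e. $\langle \operatorname{in}_\leq \Pi G\rangle=\operatorname{in}_\leq I$. Construction of the order. Let $N$ be the number of $\mathfrak S_\infty$-orbits of $Y$; for each $p\in[N]$ choose a representative $y_p$ of the $p$th orbit of minimum width, and put $k_p=w(y_p)$. Let $Y'=\{y'_{p,(\alpha_1,\dots,\alpha_{k_p})}\mid p\in[N],\ \alpha_1,\dots,\alpha_{k_p}\in\mathbb N\text{ distinct}\}$ with $\sigma y'_{p,(\alpha_1,\dots,\alpha_{k_p})}=y'_{p,(\sigma(\alpha_1),\dots,\sigma(\alpha_{k_p}))}$. Let $\theta:K[Y']\to K[Y]$ be the $\mathfrak S_\infty$-equivariant monomial map with $y'_{p,(1,\dots,k_p)}\mapsto y_p$ (it maps $Y'$ onto $Y$). Let $Z=\{z_{p,i,j}\mid p\in[N],i\in[k_p],j\in\mathbb N\}$ with $\sigma z_{p,i,j}=z_{p,i,\sigma(j)}$, and let $\pi:K[Y']\to K[Z]$ be the monomial map $y'_{p,(\alpha_1,\dots,\alpha_{k_p})}\mapsto\prod_{i\in[k_p]}z_{p,i,\alpha_i}$. Let $\mathcal M=\pi([Y'])\subseteq[Z]$, a submonoid. Choose an $\operatorname{Inc}(\mathbb N)$-respecting monomial order $\leq_1$ on $K\mathcal M$ and an $\operatorname{Inc}(\mathbb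 N)$-respecting reverse lexicographic monomial order $\leq_2$ on $K[Y']$ (among distinct monomials of the same degree, $a<_2b$ iff the smallest variable whose exponents in $a$ and $b$ differ has larger exponent in $a$). Define $\leq'$ on $[Y']$ by: $a<'b$ iff $\pi(a)<_1\pi(b)$, or $\pi(a)=\pi(b)$ and $a<_2b$. Let $\nu:[Y]\to[Y']$ be the monoid homomorphism sending $y\in Y$ to the $\leq'$-smallest variable in $Y'$ mapped to $y$ by $\theta$. Finally define $\leq$ on $[Y]$ by: $a\leq b$ iff $\nu(a)\leq'\nu(b)$. *)

(* Defs.v *)
From HB Require Import structures.
From mathcomp Require Import all_boot all_algebra finmap.
From mathcomp.multinomials Require Import monalg.

Set Implicit Arguments.
Unset Strict Implicit.
Unset Printing Implicit Defensive.

Import GRing.Theory.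

Local Open Scope ring_scope.

(** The set of indices {1, 2, 3, ...} is represented by [nat] = {0, 1, 2, ...}
    through j |-> j - 1.  Thus [n] = {1, ..., n} becomes {i | i < n}. *)

(** A finitely supported function is bijective as soon as it is injective. *)
Record finperm := FinPerm {
  finperm_val :> {fsfun nat -> nat};
  _ : fsinjectiveb finperm_val }.

Lemma finperm_inj (s : finperm) : injective s.
Proof. by case: s => f /= /fsinjectiveP. Qed.

Lemma finperm1_subproof : fsinjectiveb ([fsfun] : {fsfun nat -> nat}).
Proof. by apply/fsinjectiveP => i j; rewrite !fsfun0E. Qed.

Definition finperm1 : finperm := FinPerm finperm1_subproof.

Lemma finpermM_subproof (s t : finperm) :
  fsinjectiveb (fsfun_comp s t).
Proof.
by apply/fsinjectiveP; apply: fscomp_inj; apply: finperm_inj.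
Qed.

(** i |-> s (t i) *)
Definition finpermM (s t : finperm) : finperm := FinPerm (finpermM_subproof s t).

Definition is_action (T : Type) (act : finperm -> T -> T) : Prop :=
  (forall x, act finperm1 x = x) /\
  (forall s t x, act (finpermM s t) x = act s (act t x)).

Definition in_Inc (rho : nat -> nat) : Prop :=
  {homo rho : i j / (i < j)%N >-> (i < j)%N}.

Section Width.
Context (T : Type) (act : finperm -> T -> T).

Definition fixed_above (n : nat) (x : T) : Prop :=
  forall s : finperm, (forall i, (i < n)%N -> s i = i) -> act s x = x.

(** w(x) = n *)
Definition has_width (x : T) (n : nat) : Prop :=
  fixed_above n x /\ (forall m, fixed_above m x -> (n <= m)%N).

Definition finite_width : Prop := forall x, exists n, fixed_above n x.

(** y = rho x, where rho is in Inc(N) and x has finite width.  The element y is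
    uniquely determined by rho and x; it is given by a relation because the
    width is not computable. *)
Definition Inc_act (rho : nat -> nat) (x y : T) : Prop :=
  exists (n : nat) (s : finperm),
    [/\ has_width x n, (forall i, (i < n)%N -> s i = rho i) & y = act s x].

End Width.

(** [{cmonom V}] is the free abelian monoid [V] and [{malg K[{cmonom V}]}] is
    the polynomial ring K[V]. *)

Notation monvar y := (@ucm _ y).

Definition polyvar (K : fieldType) (V : choiceType) (v : V) :
  {malg K[{cmonom V}]} := << monvar v >>.

(** The monoid homomorphism [V] -> [W] extending f on the variables. *)
Definition mon_ext (V W : choiceType) (f : V -> {cmonom W}) (m : {cmonom V}) :
  {cmonom W} := \big[mmul/mone]_(v <- finsupp m) expcmn (f v) (m v).

Definition mon_act (V : choiceType) (act : finperm -> V -> V) (s : finperm) :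
  {cmonom V} -> {cmonom V} := mon_ext (fun v => monvar (act s v)).

(** The K-algebra automorphism of K[V] induced by the permutation [act s] of
    the variables. *)
Definition poly_act (K : fieldType) (V : choiceType) (act : finperm -> V -> V)
    (s : finperm) (f : {malg K[{cmonom V}]}) : {malg K[{cmonom V}]} :=
  mmap (fun c => c%:MP) (fun m => << mon_act act s m >>) f.

Definition monomial_map (K : fieldType) (V W : choiceType)
    (phi : {lrmorphism {malg K[{cmonom V}]} -> {malg K[{cmonom W}]}}) : Prop :=
  forall v, exists m : {cmonom W}, phi (polyvar K v) = << m >>.

Definition equivariant (A B : Type) (actA : finperm -> A -> A)
    (actB : finperm -> B -> B) (f : A -> B) : Prop :=
  forall s a, f (actA s a) = actB s (f a).

Inductive subalg_gen (K : fieldType) (A : algType K) (S : A -> Prop) :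
    A -> Prop :=
| subalg_gen_scalar (c : K) : subalg_gen S c%:A
| subalg_gen_base f : S f -> subalg_gen S f
| subalg_gen_add f g : subalg_gen S f -> subalg_gen S g -> subalg_gen S (f + g)
| subalg_gen_mul f g : subalg_gen S f -> subalg_gen S g -> subalg_gen S (f * g).

Definition Sym_finitely_generated (K : fieldType) (A : algType K)
    (act : finperm -> A -> A) : Prop :=
  exists F : seq A,
    forall f, subalg_gen (fun g => exists2 h, h \in F & exists s, g = act s h) f.

Section MonomialOrder.
Context (M : conomType) (P : M -> Prop) (le : M -> M -> Prop).

Definition monomial_order : Prop :=
  [/\ (forall a b, P a -> P b -> le a b -> le b a -> a = b),
      (forall a b c, P a -> P b -> P c -> le a b -> le b c -> le a c),
      (forall a b, P a -> P b -> le a b \/ le b a),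
      (forall S : M -> Prop, (forall a, S a -> P a) -> (exists a, S a) ->
         exists2 a, S a & forall b, S b -> le a b) &
      (forall a b c, P a -> P b -> P c -> le a b -> le (mmul a c) (mmul b c))].

Definition Inc_respecting (act : finperm -> M -> M) : Prop :=
  forall rho, in_Inc rho -> forall a b a' b', P a -> P b ->
    Inc_act act rho a a' -> Inc_act act rho b b' -> le a b -> le a' b'.

Definition strict (a b : M) : Prop := le a b /\ a <> b.

End MonomialOrder.

Definition all_monomials (V : choiceType) (m : {cmonom V}) : Prop := True.

(** The order of the variables is the restriction of [le]. *)
Definition reverse_lexicographic (V : choiceType)
    (le : {cmonom V} -> {cmonom V} -> Prop) : Prop :=
  forall a b, mdeg a = mdeg b -> a <> b ->
    (strict le a b <->
     exists v, (b v < a v)%N /\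
       forall w, a w <> b w -> le (monvar v) (monvar w)).

Definition ideal_gen (R : comNzRingType) (S : R -> Prop) (f : R) : Prop :=
  exists (n : nat) (c g : 'I_n -> R),
    (forall i, S (g i)) /\ f = \sum_(i < n) c i * g i.

Section Groebner.
Context (K : fieldType) (V : choiceType).
Context (le : {cmonom V} -> {cmonom V} -> Prop).

(** [m] is the initial monomial of [f]; this forces [f] to be nonzero. *)
Definition is_initial (f : {malg K[{cmonom V}]}) (m : {cmonom V}) : Prop :=
  m \in msupp f /\ (forall m', m' \in msupp f -> le m' m).

Definition initial_ideal (S : {malg K[{cmonom V}]} -> Prop) :
    {malg K[{cmonom V}]} -> Prop :=
  ideal_gen (fun h => exists f m, [/\ S f, is_initial f m & h = << m >>]).

Definition Inc_closure (act : finperm -> V -> V)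
    (G : {malg K[{cmonom V}]} -> Prop) (h : {malg K[{cmonom V}]}) : Prop :=
  exists rho g, [/\ in_Inc rho, G g & Inc_act (poly_act act) rho g h].

Definition Inc_groebner_basis (act : finperm -> V -> V)
    (I G : {malg K[{cmonom V}]} -> Prop) : Prop :=
  (forall g, G g -> I g) /\
  (forall f, initial_ideal (Inc_closure act G) f <-> initial_ideal I f).

End Groebner.

Definition varX (l : nat) : choiceType := ('I_l * nat)%type.

Definition actX (l : nat) (s : finperm) (x : varX l) : varX l := (x.1, s x.2).

Section Construction.
Context (N : nat) (k : 'I_N -> nat).

Definition dtuple (n : nat) : choiceType := {t : n.-tuple nat | uniq t}.

Definition varY' : choiceType := {p : 'I_N & dtuple (k p)}.

Lemma dtuple_act_subproof n (s : finperm) (t : dtuple n) :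
  uniq (map_tuple s (val t)).
Proof. by rewrite map_inj_uniq ?(valP t) //; exact: finperm_inj. Qed.

Definition dtuple_act n (s : finperm) (t : dtuple n) : dtuple n :=
  exist (fun t : n.-tuple nat => uniq t) _ (dtuple_act_subproof s t).

Definition actY' (s : finperm) (y : varY') : varY' :=
  Tagged (fun p => dtuple (k p)) (dtuple_act s (tagged y)).

Lemma dtuple_iota_subproof n : uniq (iota_tuple n 0).
Proof. exact: iota_uniq. Qed.

Definition dtuple_iota n : dtuple n := 
  exist (fun t : n.-tuple nat => uniq t) _ (dtuple_iota_subproof n).

(** y'_(p,(1,...,k_p)) *)
Definition baseY' (p : 'I_N) : varY' :=
  Tagged (fun p => dtuple (k p)) (dtuple_iota (k p)).

Definition varZ : choiceType := {p : 'I_N & ('I_(k p) * nat)%type}.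

Definition zvar (p : 'I_N) (i : 'I_(k p)) (j : nat) : varZ :=
  Tagged (fun p => ('I_(k p) * nat)%type) (i, j).

Definition actZ (s : finperm) (z : varZ) : varZ :=
  zvar (tagged z).1 (s (tagged z).2).

(** The restriction of pi to monomials, pi : [Y'] -> [Z]. *)
Definition pi_mon : {cmonom varY'} -> {cmonom varZ} :=
  mon_ext (fun y => \big[mmul/mone]_(i < k (tag y))
                      monvar (zvar i (tnth (val (tagged y)) i))).

Definition pi_image (m : {cmonom varZ}) : Prop := exists a, pi_mon a = m.

Definition lt' (le1 : {cmonom varZ} -> {cmonom varZ} -> Prop)
    (le2 : {cmonom varY'} -> {cmonom varY'} -> Prop)
    (a b : {cmonom varY'}) : Prop :=
  strict le1 (pi_mon a) (pi_mon b) \/ (pi_mon a = pi_mon b /\ strict le2 a b).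

Definition le' (le1 : {cmonom varZ} -> {cmonom varZ} -> Prop)
    (le2 : {cmonom varY'} -> {cmonom varY'} -> Prop)
    (a b : {cmonom varY'}) : Prop := a = b \/ lt' le1 le2 a b.

Context (K : fieldType) (Y : choiceType) (act : finperm -> Y -> Y).

(** The y_p represent the N orbits of Y, each orbit once; y_p has minimal width
    in its orbit, and this width is k_p. *)
Definition is_representatives (rep : 'I_N -> Y) : Prop :=
  [/\ (forall y, exists! p, exists s, y = act s (rep p)),
      (forall p, has_width act (rep p) (k p)) &
      (forall p s n, has_width act (act s (rep p)) n -> (k p <= n)%N)].

Definition is_theta (rep : 'I_N -> Y)
    (theta : {lrmorphism {malg K[{cmonom varY'}]} -> {malg K[{cmonom Y}]}}) :
    Prop :=
  [/\ monomial_map theta,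
      equivariant (poly_act actY') (poly_act act) theta &
      (forall p, theta (polyvar K (baseY' p)) = polyvar K (rep p))].

Definition is_nu
    (theta : {lrmorphism {malg K[{cmonom varY'}]} -> {malg K[{cmonom Y}]}})
    (le : {cmonom varY'} -> {cmonom varY'} -> Prop) (nu : Y -> varY') : Prop :=
  forall y, theta (polyvar K (nu y)) = polyvar K y /\
    (forall v, theta (polyvar K v) = polyvar K y ->
       le (monvar (nu y)) (monvar v)).

End Construction.

Definition constructed_order (K : fieldType) (Y : choiceType)
    (act : finperm -> Y -> Y) (le : {cmonom Y} -> {cmonom Y} -> Prop) : Prop :=
  exists (N : nat) (k : 'I_N -> nat) (rep : 'I_N -> Y)
    (theta : {lrmorphism {malg K[{cmonom varY' k}]} -> {malg K[{cmonom Y}]}})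
    (le1 : {cmonom varZ k} -> {cmonom varZ k} -> Prop)
    (le2 : {cmonom varY' k} -> {cmonom varY' k} -> Prop)
    (nu : Y -> varY' k),
  [/\ is_representatives k act rep,
      is_theta act rep theta,
      monomial_order (@pi_image N k) le1 /\
        Inc_respecting (@pi_image N k) le1 (mon_act (@actZ N k)),
      [/\ monomial_order (@all_monomials _) le2,
          Inc_respecting (@all_monomials _) le2 (mon_act (@actY' N k)) &
          reverse_lexicographic le2] &
      is_nu theta (le' le1 le2) nu /\
        (forall a b : {cmonom Y},
           le a b <->
           le' le1 le2 (mon_ext (fun y => monvar (nu y)) a)
                       (mon_ext (fun y => monvar (nu y)) b))].

(* Main.v *)
Require Import Defs.
From HB Require Import structures.
From mathcomp Require Import all_boot all_algebra perm finmap zify.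
From mathcomp.multinomials Require Import monalg.
From Stdlib Require Import Classical ClassicalEpsilon.

Set Implicit Arguments.
Unset Strict Implicit.
Unset Printing Implicit Defensive.

(** Since phi maps variables to monomials, its kernel is spanned by the
    differences of two monomials with the same image, and the initial monomials of
    its elements are exactly the nonminimal monomials: those for which a smaller
    monomial has the same image.  What has to be shown is that finitely many
    nonminimal monomials generate all of them up to multiplication and Inc(N).

    The question is first moved from [Y] to [Y'].  The image of y'_(p,alpha) under
    theta determines the set of entries of alpha, because y_p has the smallest
    width in its orbit ([theta_var_entries]).  It follows that nu commutes with
    Inc(N) ([nu_act]), so that the order on [Y] is Inc(N)-respecting, and that
    generators for the nonminimal monomials in [Y'] yield generators for those in
    [Y] ([finite_nonminimal_generators]).  For both <=_1 and <=_2 the graded reverse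
    lexicographic order is taken.

    The image of y_p under phi involves only the first k_p indices, so the
    composite of theta and phi factors through pi ([fibre_map_pi]).  Hence a
    monomial u in [Y'] is nonminimal for one of two reasons: (a) some v with
    smaller pi(v) has the same image under phi, which is a property of pi(u); or
    (b) some v <_2 u has pi(v) = pi(u).  In both cases u turns out to be divisible by
    a nonminimal monomial of bounded degree.

    A monomial in [Y'] is, for each p, a list of rows alpha with distinct entries,
    and pi remembers only what occurs in each column.  By Koenig's theorem on edge
    colourings ([koenig]), a table of column contents comes from a list of d rows
    exactly when every column has d entries and no value occurs more than d times.
    This describes divisibility in the image M of pi ([column_cofactor]) and has
    two consequences.
    - If pi(u) is divisible in M by pi(q), then so is pi(u0) for some divisor u0 of u
      whose degree is bounded in terms of the degree of q ([divisor_of_rows]).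
    - M is well-quasi-ordered by divisibility up to Inc(N)
      ([good_Inc_divides]).  An element of M is encoded as a word whose letter at b
      counts the occurrences of b in each column and the rows that avoid b, and
      Higman's lemma applies.  The delicate point is that the values skipped by
      an embedding must not occur too often in the larger element; this is
      ensured by comparing the degrees so that they are equal or differ by a
      factor of at least two, and by marking the few values that lie in more
      than half of the rows.
    In case (a), the well-quasi-order gives finitely many q, and the first
    consequence bounds the degree.  In case (b), after cancelling common factors, v
    contains a variable y smaller than all variables of u; the first consequence
    for q = y gives a bounded u0 with pi(u0) = pi(y w0), and y w0 <_2 u0 by the
    definition of a reverse lexicographic order.

    Finally, the monomials in [Y'] of bounded degree are themselves
    well-quasi-ordered by the action of Inc(N), again by Higman's lemma
    ([bounded_size_basis]), so finitely many of the bounded nonminimal monomials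
    suffice ([nonminimal_finite_basis]). *)

(** * Well-quasi-orders *)

(** For a reflexive and transitive relation, this says that it is a
    well-quasi-order. *)
Definition good (T : Type) (R : T -> T -> Prop) : Prop :=
  forall f : nat -> T, exists i j, (i < j)%N /\ R (f i) (f j).

Definition transitive_rel (T : Type) (R : T -> T -> Prop) : Prop :=
  forall y x z, R x y -> R y z -> R x z.

Lemma choice_nat (T : Type) (P : nat -> T -> Prop) :
  (forall n, exists x, P n x) -> exists f, forall n, P n (f n).
Proof.
move=> h; exists (fun n => sval (constructive_indefinite_description _ (h n))).
by move=> n; case: constructive_indefinite_description.
Qed.

Lemma nat_min (P : nat -> Prop) : (exists m, P m) ->
  exists2 m, P m & forall m', P m' -> (m <= m')%N.
Proof.
move=> [m Pm]; elim/ltn_ind: m Pm => m IH Pm.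
case: (classic (exists2 m', P m' & (m' < m)%N)) => [[m' Pm' m'm]|h]; first exact: IH m' m'm Pm'.
by exists m => // m' Pm'; rewrite leqNgt; apply/negP => ?; apply: h; exists m'.
Qed.

Lemma increasing_of_step (f : nat -> nat) :
  (forall n, (f n < f n.+1)%N) -> {homo f : i j / (i < j)%N}.
Proof. by move=> h; apply: (homo_ltn ltn_trans h). Qed.

Lemma infinite_subsequence (P : nat -> Prop) :
  (forall n, exists m, (n <= m)%N /\ P m) ->
  exists g : nat -> nat, {homo g : i j / (i < j)%N} /\ forall n, P (g n).
Proof.
move=> /choice_nat [h hP].
pose g := fix g n := if n is n'.+1 then h (g n').+1 else h 0.
exists g; split.
  by apply: (@increasing_of_step g) => n; case: (hP (g n).+1).
by case=> [|n]; [case: (hP 0) | case: (hP (g n).+1)].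
Qed.

(** If infinitely many terms were terminal, that is, below none of the later
    terms, then they would form a sequence without a good pair.  Hence from some
    point on every term is below a later one, and a subsequence can be built
    step by step. *)
Lemma good_monotone_subsequence (T : Type) (R : T -> T -> Prop) (f : nat -> T) :
  transitive_rel R -> good R ->
  exists g : nat -> nat, {homo g : i j / (i < j)%N} /\
    forall i j, (i < j)%N -> R (f (g i)) (f (g j)).
Proof.
move=> Rtrans Rgood.
pose terminal i := forall j, (i < j)%N -> ~ R (f i) (f j).
have [n0 n0P] : exists n0, forall i, (n0 <= i)%N -> ~ terminal i.
  apply: NNPP => h; have /infinite_subsequence [g [gmono gterm]] :
      forall n, exists m, (n <= m)%N /\ terminal m.
    move=> n; apply: NNPP => h'; apply: h; exists n => i ni ti.
    by apply: h'; exists i.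
  have [i [j [ij Rij]]] := Rgood (f \o g).
  exact: gterm (gmono _ _ ij) Rij.
have [h hP] : exists h, forall i, (n0 <= i)%N ->
    (i < h i)%N /\ R (f i) (f (h i)).
  apply: (choice_nat (P := fun i x => (n0 <= i)%N -> (i < x)%N /\ R (f i) (f x))).
  move=> i; case: (leqP n0 i) => [ni|]; last by exists 0.
  apply: NNPP => h; apply: (n0P _ ni) => j ij Rij; apply: h.
  by exists j.
pose g n := iter n h n0.
have gge n : (n0 <= g n)%N.
  by elim: n => //= n IH; apply: leq_trans IH (ltnW (hP _ IH).1).
exists g; split; first by apply: (@increasing_of_step g) => n; exact: (hP _ (gge n)).1.
move=> i j; elim: j => // j IH; rewrite ltnS leq_eqVlt => /predU1P[->|/IH Rij].
  exact: (hP _ (gge j)).2.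
exact: Rtrans Rij (hP _ (gge j)).2.
Qed.

Lemma good_preimage (S T : Type) (h : S -> T) (R : T -> T -> Prop) :
  good R -> good (fun x y => R (h x) (h y)).
Proof. by move=> Rgood f; apply: (Rgood (h \o f)). Qed.

Lemma good_sub (T : Type) (R R' : T -> T -> Prop) :
  (forall x y, R x y -> R' x y) -> good R -> good R'.
Proof. by move=> RR' Rgood f; have [i [j [ij /RR' ?]]] := Rgood f; exists i, j. Qed.

(** A monotone subsequence for the first relation contains a good pair for the
    second one. *)
Lemma good_and (T : Type) (R S : T -> T -> Prop) :
  transitive_rel R -> good R -> good S -> good (fun x y => R x y /\ S x y).
Proof.
move=> Rtrans Rgood Sgood f.
have [g [gmono gR]] := good_monotone_subsequence f Rtrans Rgood.
have [i [j [ij Sij]]] := Sgood (f \o g).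
by exists (g i), (g j); split; [exact: gmono | split => //; exact: gR].
Qed.

Lemma good_forall (I : finType) (T : Type) (R : T -> T -> Prop) :
  transitive_rel R -> good R ->
  good (fun x y : I -> T => forall i, R (x i) (y i)).
Proof.
move=> Rtrans Rgood.
suff h (L : seq I) : good (fun x y : I -> T => forall i, i \in L -> R (x i) (y i)).
  by apply: good_sub (h (enum I)) => x y xy i; apply: xy; rewrite mem_enum.
elim: L => [|a L IH]; first by move=> f; exists 0, 1.
have : good (fun x y : I -> T => R (x a) (y a)) by apply: good_preimage.
move/good_and => /(_ _ (fun y x z => @Rtrans _ _ _) IH).
by apply: good_sub => x y [Ra RL] i; rewrite inE => /predU1P[->|/RL].
Qed.

Lemma good_leq : good (fun m n : nat => (m <= n)%N).
Proof.
move=> f; apply: NNPP => h.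
have fP i : (f i.+1 < f i)%N.
  by rewrite ltnNge; apply/negP => fi; apply: h; exists i, i.+1.
have : forall i, (f i + i <= f 0)%N by elim=> [|i IH]; [lia | have := fP i; lia].
by move/(_ (f 0).+1); lia.
Qed.

Lemma good_leq_fun (I : finType) :
  good (fun x y : I -> nat => forall i, (x i <= y i)%N).
Proof. by apply: good_forall good_leq => y x z; apply: leq_trans. Qed.

Lemma leq_fun_trans (I : finType) :
  transitive_rel (fun x y : I -> nat => forall i, (x i <= y i)%N).
Proof. by move=> y x z xy yz i; apply: leq_trans (xy i) (yz i). Qed.

(** This relation refines the order of the natural numbers so that a number
    below n is either n or so small that n exceeds it by at least n/2.  It takes
    care of the numbers of factors of two monomials in [word_le]. *)
Definition eq_or_double (m n : nat) : Prop := m = n \/ (m.*2 <= n)%N.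

Lemma eq_or_double_trans : transitive_rel eq_or_double.
Proof. by rewrite /eq_or_double => y x z; lia. Qed.

(** A sequence without a term doubling the first one is bounded by some B, and
    then m <= n together with B - m <= B - n forces equality. *)
Lemma good_eq_or_double : good eq_or_double.
Proof.
move=> f; case: (classic (exists j, (0 < j)%N /\ ((f 0).*2 <= f j)%N)).
  by case=> j [j0 fj]; exists 0, j; split=> //; right.
move=> h; have fB j : (0 < j)%N -> (f j < (f 0).*2)%N.
  by move=> j0; rewrite ltnNge; apply/negP => fj; apply: h; exists j.
pose B := (f 0).*2.
have [||i [j [ij [le1 le2]]]] :=
  @good_and nat (fun m n => (m <= n)%N) (fun m n => (B - m <= B - n)%N) _
    good_leq _ (fun n => f n.+1).
- by move=> y x z; apply: leq_trans.
- exact: (@good_preimage _ _ (fun m => B - m)%N _ good_leq).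
exists i.+1, j.+1; split=> //; left.
by have := fB i.+1 isT; have := fB j.+1 isT; rewrite -/B; lia.
Qed.

(** Without a finite basis, elements of S could be chosen one after the other,
    each of them above none of those chosen before. *)
Lemma good_finite_basis (T : eqType) (R : T -> T -> Prop) (S : T -> Prop) :
  (forall x, R x x) -> good R ->
  exists F : seq T, (forall x, x \in F -> S x) /\
    forall x, S x -> exists2 y, y \in F & R y x.
Proof.
move=> Rrefl Rgood; apply: NNPP => h.
have ext (F : seq T) : exists x, (forall y, y \in F -> S y) ->
    S x /\ forall y, y \in F -> ~ R y x.
  case: (classic (forall y, y \in F -> S y)) => FS; last first.
    case: F FS => [|x F] FS; last by exists x => /FS.
    by case: FS.
  apply: NNPP => h'; apply: h; exists F; split => // x Sx.
  apply: NNPP => h''; apply: h'; exists x => _; split=> // y yF Ryx.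
  by apply: h''; exists y.
pose c F := sval (constructive_indefinite_description _ (ext F)).
have cP F : (forall y, y \in F -> S y) -> S (c F) /\ forall y, y \in F -> ~ R y (c F).
  by rewrite /c; case: constructive_indefinite_description.
pose L := fix L n := if n is n'.+1 then c (L n') :: L n' else [::].
have LS n : forall y, y \in L n -> S y.
  elim: n => //= n IH y; rewrite inE => /predU1P[->|/IH //].
  exact: (cP _ IH).1.
have Lmono i j : (i < j)%N -> c (L i) \in L j.
  elim: j => // j IH; rewrite ltnS leq_eqVlt inE => /predU1P[->|/IH ->].
    by rewrite eqxx.
  by rewrite orbT.
have [i [j [ij Rij]]] := Rgood (fun n => c (L n)).
exact: (cP _ (LS j)).2 _ (Lmono _ _ ij) Rij.
Qed.

(** * Higman's lemma *)

Inductive embeds (T : Type) (R : T -> T -> Prop) : seq T -> seq T -> Prop :=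
| embeds_nil t : embeds R [::] t
| embeds_skip s y t : embeds R s t -> embeds R s (y :: t)
| embeds_cons x s y t : R x y -> embeds R s t -> embeds R (x :: s) (y :: t).

(** The positions are extended to a map defined on all natural numbers, so that
    it belongs to Inc(N). *)
Lemma embeds_index (T : Type) (x0 : T) (R : T -> T -> Prop) s t :
  embeds R s t -> exists rho, in_Inc rho /\
    forall i, (i < size s)%N ->
      (rho i < size t)%N /\ R (nth x0 s i) (nth x0 t (rho i)).
Proof.
elim=> {s t} [t|s y t _ [rho [rhoI rhoP]]|x s y t Rxy _ [rho [rhoI rhoP]]].
- by exists id; split.
- by exists (fun i => (rho i).+1); split=> // i j ij; rewrite ltnS; apply: rhoI.
exists (fun i => if i is i'.+1 then (rho i').+1 else 0); split.
  by case=> [|i] [|j] //; rewrite !ltnS => /rhoI.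
by case=> [|i] //=; rewrite !ltnS => /rhoP.
Qed.

Definition bad (T : Type) (R : T -> T -> Prop) (f : nat -> T) : Prop :=
  forall i j, (i < j)%N -> ~ R (f i) (f j).

(** The minimal bad sequence of Nash-Williams.  The n-th step replaces the
    current bad sequence by one that agrees with it below n and has the smallest
    possible n-th term; the diagonal of these sequences is the result. *)
Lemma minimal_bad_sequence (T : Type) (m : T -> nat) (R : T -> T -> Prop) f :
  bad R f -> exists2 g, bad R g &
    forall n c, bad R c -> (forall i, (i < n)%N -> c i = g i) ->
      (m (g n) <= m (c n))%N.
Proof.
move=> badf.
have step (bn : (nat -> T) * nat) : exists b', bad R bn.1 ->
    [/\ bad R b', (forall i, (i < bn.2)%N -> b' i = bn.1 i) &
      forall c, bad R c -> (forall i, (i < bn.2)%N -> c i = bn.1 i) ->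
        (m (b' bn.2) <= m (c bn.2))%N].
  case: bn => b n /=; case: (classic (bad R b)) => badb; last by exists b.
  have [|k [b' [badb' b'b b'k]] kmin] := @nat_min (fun k => exists c,
      [/\ bad R c, (forall i, (i < n)%N -> c i = b i) & m (c n) = k]).
    by exists (m (b n)), b.
  by exists b' => _; split=> // c badc cb; rewrite b'k; apply: kmin; exists c.
pose st bn := sval (constructive_indefinite_description _ (step bn)).
have stP bn : bad R bn.1 ->
    [/\ bad R (st bn), (forall i, (i < bn.2)%N -> st bn i = bn.1 i) &
      forall c, bad R c -> (forall i, (i < bn.2)%N -> c i = bn.1 i) ->
        (m (st bn bn.2) <= m (c bn.2))%N].
  by rewrite /st; case: constructive_indefinite_description.
pose b := fix b n := if n is n'.+1 then st (b n', n') else f.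
have badb n : bad R (b n).
  by elim: n => //= n IH; have [] := stP (b n, n) IH.
have bstab i n : (i < n)%N -> b n i = b i.+1 i.
  elim: n => // n IH; rewrite ltnS leq_eqVlt => /predU1P[-> //|lt_in].
  rewrite -(IH lt_in) /=; have [_ h _] := stP (b n, n) (badb n); exact: h.
exists (fun n => b n.+1 n).
  by move=> i j ij; have := @badb j.+1 i j ij; rewrite (bstab i j.+1) 1?ltnS 1?leq_eqVlt ?ij ?orbT.
move=> n c badc cg; have [_ _ h] := stP (b n, n) (badb n).
by apply: h => // i lt_in /=; rewrite cg // bstab.
Qed.

(** In a minimal bad sequence of words, the first letters have a monotone
    subsequence; deleting them from the words of this subsequence, and keeping
    the words before it, gives a smaller bad sequence. *)
Lemma higman (T : Type) (R : T -> T -> Prop) :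
  transitive_rel R -> good R -> good (embeds R).
Proof.
move=> Rtrans Rgood f0; apply: NNPP => h.
have badf0 : bad (embeds R) f0.
  by move=> i j ij Rij; apply: h; exists i, j.
have [g badg gmin] := minimal_bad_sequence size badf0.
have [hd hdP] : exists hd : nat -> T * seq T, forall n, g n = (hd n).1 :: (hd n).2.
  apply: (choice_nat (P := fun n (x : T * seq T) => g n = x.1 :: x.2)) => n.
  case gn : (g n) => [|x s]; last by exists (x, s).
  by case: (badg n n.+1) => //; rewrite gn; constructor.
have [phi [phimono phiR]] := good_monotone_subsequence (fun n => (hd n).1) Rtrans Rgood.
pose c i := if (i < phi 0)%N then g i else (hd (phi (i - phi 0)%N)).2.
have badc : bad (embeds R) c.
  move=> i j ij; rewrite /c; case: ltnP => i0; case: ltnP => j0.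
  - exact: badg.
  - move=> emb; apply: (badg i (phi (j - phi 0)%N)).
      apply: leq_trans i0 _; case: (posnP (j - phi 0)%N) => [-> //|lt0].
      exact/ltnW/phimono.
    by rewrite (hdP (phi _)); constructor.
  - by lia.
  have ij' : (i - phi 0 < j - phi 0)%N by lia.
  move=> emb; apply: (badg _ _ (phimono _ _ ij')).
  by rewrite !(hdP (phi _)); constructor => //; apply: phiR.
have := gmin (phi 0) c badc.
rewrite /c ltnn subnn hdP /= => h2.
suff: (size (hd (phi 0)).2).+1 <= size (hd (phi 0)).2 by rewrite ltnn.
by apply: h2 => i ->.
Qed.

(** * Edge colourings of bipartite multigraphs *)

(** A row with holes: the edges of one colour, seen as a partial injection from
    the left vertices to the right vertices. *)
Definition partial_row (k : nat) (r : 'I_k -> option nat) : Prop :=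
  forall i j b, r i = Some b -> r j = Some b -> i = j.

(** The set S of left vertices is the Kempe chain from i0 for the two colours r
    and s: the right vertex joined to i by an s-edge may be joined to another
    left vertex by an r-edge.  Exchanging the colours on S moves the hole of r at
    i0 to the other row, which still avoids b. *)
Section KempeChain.
Context (k : nat) (r s : 'I_k -> option nat) (i0 : 'I_k) (b : nat).

Let e (i j : 'I_k) := (s i != None) && (r j == s i).
Let S := connect e i0.

Definition kempe_swap1 (i : 'I_k) := if S i then s i else r i.
Definition kempe_swap2 (i : 'I_k) := if S i then r i else s i.

Hypotheses (r_row : partial_row r) (s_row : partial_row s).
Hypotheses (r_hole : r i0 = None) (s_free : forall i, s i <> Some b).

Lemma kempe_closed i j c : S i -> s i = Some c -> r j = Some c -> S j.
Proof.
move=> Si sic rjc; apply: connect_trans Si _; apply: connect1.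
by rewrite /e sic rjc eqxx.
Qed.

(** The chain starts at a hole of r, so any of its vertices with an r-edge is
    not the first one. *)
Lemma kempe_pred j c : S j -> r j = Some c -> exists2 i, S i & s i = Some c.
Proof.
move=> /connectP [p]; case: (lastP p) => [_ ->|q x]; first by rewrite r_hole.
rewrite rcons_path last_rcons => /andP[pq /andP[_ /eqP xq]] -> <-.
by exists (last i0 q); [apply/connectP; exists q | rewrite -xq].
Qed.

Lemma kempe_swap1_row : partial_row kempe_swap1.
Proof.
move=> i j c; rewrite /kempe_swap1; case: ifP => Si; case: ifP => Sj.
- exact: s_row.
- by move=> h1 h2; rewrite (kempe_closed Si h1 h2) in Sj.
- by move=> h1 h2; rewrite (kempe_closed Sj h2 h1) in Si.
exact: r_row.
Qed.

Lemma kempe_swap2_row : partial_row kempe_swap2.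
Proof.
move=> i j c; rewrite /kempe_swap2; case: ifP => Si; case: ifP => Sj.
- exact: r_row.
- by move=> /(kempe_pred Si)[i' Si' h1] h2; rewrite -(s_row h1 h2) Si' in Sj.
- by move=> h1 /(kempe_pred Sj)[i' Si' h2]; rewrite -(s_row h2 h1) Si' in Si.
exact: s_row.
Qed.

Lemma kempe_swap2_hole : kempe_swap2 i0 = None.
Proof. by rewrite /kempe_swap2 /S connect0. Qed.

Lemma kempe_swap2_free i : kempe_swap2 i <> Some b.
Proof.
rewrite /kempe_swap2; case: ifP => Si; last exact: s_free.
by move=> /(kempe_pred Si)[j _ /s_free].
Qed.

End KempeChain.

Lemma leq_card_bigcup (I T : finType) (A : I -> {set T}) :
  (#|\bigcup_i A i| <= \sum_i #|A i|)%N.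
Proof.
elim/big_rec2: _ => [|i n B _ IH]; first by rewrite cards0.
by apply: leq_trans (leq_card_setU _ _) _; rewrite leq_add2l.
Qed.

Section Koenig.
Context (k d : nat).

(** The multigraph on the left vertices 'I_k and the right vertices nat is given
    by the list E of its edges; R c i is the right vertex joined to i by the edge
    of colour c, if there is one. *)
Definition is_coloring (E : seq ('I_k * nat)) (R : 'I_d -> 'I_k -> option nat) :=
  [/\ forall c, partial_row (R c),
      forall i b, #|[set c | R c i == Some b]| = count_mem (i, b) E &
      forall i, #|[set c | R c i != None]| = count (fun e => e.1 == i) E].

(** Counting gives a colour a missing at the left vertex i and a colour c missing
    at the right vertex b; a Kempe exchange makes c missing at both. *)
Lemma coloring_hole_free E R i b : is_coloring E R ->
    (count (fun e => e.1 == i) E < d)%N -> (count (fun e => e.2 == b) E < d)%N ->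
  exists c R', [/\ is_coloring E R', R' c i = None & forall j, R' c j <> Some b].
Proof.
move=> [Rrow Rcnt Rfull] di db.
have [a Ra] : exists a, R a i = None.
  have : (0 < #|~: [set c | R c i != None]|)%N.
    by have := cardsC [set c | R c i != None]; rewrite Rfull card_ord; lia.
  by rewrite card_gt0 => /set0Pn [a]; rewrite !inE negbK => /eqP; exists a.
have [c Rc] : exists c, forall j, R c j <> Some b.
  have : (#|\bigcup_j [set c | R c j == Some b]| < d)%N.
    apply: leq_ltn_trans db; apply: leq_trans (leq_card_bigcup _) _ => /=.
    rewrite (eq_bigr (fun j => count_mem (j, b) E)) => [|j _]; last exact: Rcnt.
    elim: E {Rcnt Rfull di} => [|[i' b'] E IH]; first by rewrite big1.
    rewrite /= big_split /= leq_add //.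
    case: eqP => [->|nb]; last first.
      rewrite big1 // => j _; rewrite xpair_eqE; case: eqP => // _.
      by apply/eqP; rewrite eqb0; case: eqP nb.
    rewrite (bigD1 i') //= eqxx big1 // => j ji.
    by rewrite xpair_eqE eq_sym (negbTE ji).
  move=> lt_d; have : (0 < #|~: \bigcup_j [set c | R c j == Some b]|)%N.
    by have := cardsC (\bigcup_j [set c | R c j == Some b]); rewrite card_ord; lia.
  rewrite card_gt0 => /set0Pn [c]; rewrite inE => /bigcupP h; exists c => j Rj.
  by apply: h; exists j => //; rewrite inE Rj.
case: (altP (R c i =P None)) => [|Rci]; first by exists c, R.
have ac : a != c by apply: contraNneq Rci => <-; rewrite Ra.
pose S := connect (fun i j => (R c i != None) && (R a j == R c i)) i.
pose R' x := if x == a then kempe_swap1 (R a) (R c) i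
             else if x == c then kempe_swap2 (R a) (R c) i else R x.
(* in each column the exchange just permutes the colours *)
pose sg j x := if S j then tperm a c x else x.
have sg_inj j : injective (sg j).
  by rewrite /sg; case: (S j) => // x y; apply: perm_inj.
have R'E x j : R' x j = R (sg j x) j.
  rewrite /R' /sg; case: (altP (x =P a)) => [->|xa].
    by rewrite tpermL /kempe_swap1 -/(S j); case: (S j).
  case: (altP (x =P c)) => [->|xc].
    by rewrite tpermR /kempe_swap2 -/(S j); case: (S j).
  by rewrite tpermD 1?eq_sym //; case: ifP.
have cardR' (P : pred (option nat)) j : #|[set x | P (R' x j)]| = #|[set x | P (R x j)]|.
  rewrite -(card_imset _ (@sg_inj j)); congr #|pred_of_set _|; apply/setP => x.
  rewrite inE; apply/imsetP/idP => [[y] | Px].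
    by rewrite inE R'E => ? ->.
  exists (sg j x); last by rewrite /sg; case: (S j) => //; rewrite tpermK.
  by rewrite inE R'E /sg; case: (S j) => //; rewrite tpermK.
exists c, R'; split.
- split; [move=> x | move=> j b' | move=> j].
  + rewrite /R'; case: eqP => _; last case: eqP => _ //.
      exact: kempe_swap1_row.
    exact: kempe_swap2_row.
  + by rewrite -Rcnt (cardR' (fun o => o == Some b')).
  + by rewrite -Rfull (cardR' (fun o => o != None)).
- by rewrite /R' eq_sym (negbTE ac) eqxx kempe_swap2_hole.
by move=> j; rewrite /R' eq_sym (negbTE ac) eqxx; apply: kempe_swap2_free.
Qed.

(** Koenig's theorem: d colours suffice when all degrees are at most d.  The
    edges are coloured one at a time. *)
Lemma koenig (E : seq ('I_k * nat)) :
  (forall i, (count (fun e => e.1 == i) E <= d)%N) ->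
  (forall b, (count (fun e => e.2 == b) E <= d)%N) ->
  exists R, is_coloring E R.
Proof.
elim: E => [|[i b] E IH] hl hr.
  exists (fun _ _ => None); split=> //= *; apply/eqP; rewrite cards_eq0; apply/eqP/setP => x; rewrite !inE //.
have [||R0 R0P] := IH.
- by move=> j; apply: leq_trans (hl j); rewrite /= leq_addl.
- by move=> j; apply: leq_trans (hr j); rewrite /= leq_addl.
have [||c [R [[Rrow Rcnt Rfull] Rci Rcb]]] := coloring_hole_free (i := i) (b := b) R0P.
- by have := hl i; rewrite /= eqxx.
- by have := hr b; rewrite /= eqxx.
pose R' x j := if (x == c) && (j == i) then Some b else R x j.
have R'D x j : (x == c) && (j == i) = false -> R' x j = R x j by rewrite /R' => ->.
exists R'; split.
- move=> x j j' b'; rewrite /R'.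
  case: (altP (x =P c)) => [->|_] /=; last exact: Rrow.
  case: (altP (j =P i)) => [->|_]; case: (altP (j' =P i)) => [->|_] //.
  + by move=> [<-] /Rcb.
  + by move=> h1 [h2]; rewrite -h2 in h1; case: (Rcb _ h1).
  exact: Rrow.
- move=> j b' /=; rewrite -Rcnt xpair_eqE.
  case: (altP (i =P j)) => [<-|ij] /=; last first.
    by congr #|pred_of_set _|; apply/setP => x; rewrite !inE R'D // (eq_sym j) (negbTE ij) andbF.
  case: (altP (b =P b')) => [<-|bb'] /=.
    have := cardsU1 c [set x | R x i == Some b]; rewrite inE Rci /= => <-.
    congr #|pred_of_set _|; apply/setP => x; rewrite !inE /R' eqxx andbT.
    by case: (x == c); rewrite ?eqxx.
  congr #|pred_of_set _|; apply/setP => x; rewrite !inE /R' eqxx andbT.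
  by case: (altP (x =P c)) => // ->; rewrite Rci -[LHS]/(b == b') (negbTE bb').
move=> j /=; rewrite -Rfull.
case: (altP (i =P j)) => [<-|ij] /=; last first.
  by congr #|pred_of_set _|; apply/setP => x; rewrite !inE R'D // (eq_sym j) (negbTE ij) andbF.
have := cardsU1 c [set x | R x i != None]; rewrite inE Rci /= => <-.
congr #|pred_of_set _|; apply/setP => x; rewrite !inE /R' eqxx andbT.
by case: (x == c).
Qed.

End Koenig.

(** * Lists of variables up to column-wise rearrangement *)

Section Indices.
Context (V : choiceType) (ents : V -> seq nat).

Definition index_bound (l : seq V) : nat :=
  (\max_(v <- l) \max_(b <- ents v) b).+1.

Lemma index_boundP l v b : v \in l -> b \in ents v -> (b < index_bound l)%N.
Proof.
move=> vl bv.
have h1 := @leq_bigmax_seq _ (ents v) predT (fun a : nat => a) _ bv isT.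
have h2 := @leq_bigmax_seq _ l predT (fun y => \max_(a <- ents y) a)%N _ vl isT.
exact: leq_trans h1 h2.
Qed.

Definition agrees (s : finperm) (rho : nat -> nat) (l : seq V) : Prop :=
  forall v b, v \in l -> b \in ents v -> s b = rho b.

Lemma agrees_cat s rho l m :
  agrees s rho (l ++ m) -> agrees s rho l /\ agrees s rho m.
Proof.
by move=> h; split=> v b vl; apply: h; rewrite mem_cat vl ?orbT.
Qed.

Lemma agrees_index_bound (s : finperm) rho l :
  (forall i, (i < index_bound l)%N -> s i = rho i) -> agrees s rho l.
Proof. by move=> h v b vl bv; apply: h; apply: index_boundP bv. Qed.

End Indices.

(** A list of variables y'_(p,alpha) is thought of as a stack of rows alpha, one
    block for each p.  The monomial pi of the list only records the multiset of
    entries of each column (p, i). *)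
Section Columns.
Context (N : nat) (k : 'I_N -> nat).
Local Notation Y' := (varY' k).

Definition entries (y : Y') : seq nat := val (val (tagged y)).

Lemma size_entries y : size (entries y) = k (tag y).
Proof. by rewrite size_tuple. Qed.

Lemma uniq_entries y : uniq (entries y).
Proof. exact: valP (tagged y). Qed.

Lemma varY'_eq y z : tag y = tag z -> entries y = entries z -> y = z.
Proof.
case: y z => [p t] [q u] /= pq; case: q / pq u => u tu.
by congr existT; apply/val_inj/val_inj.
Qed.

Lemma varY'_exists p s : size s = k p -> uniq s ->
  exists y : Y', tag y = p /\ entries y = s.
Proof.
move=> /eqP ss us.
by exists (Tagged (fun p => dtuple (k p))
  (exist (fun t : (k p).-tuple nat => uniq t) (Tuple ss) us)).
Qed.

Lemma entries_act s y : entries (actY' s y) = map s (entries y).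
Proof. by []. Qed.

Definition has_entry p i b (y : Y') := (tag y == p) && (nth 0 (entries y) i == b).
Definition cell p i b : seq Y' -> nat := count (has_entry p i b).
Definition height p : seq Y' -> nat := count (fun y => tag y == p).

(** In the bipartite multigraph that joins the column i to the entries of the
    column (p, i), this is the degree of b, and [height p] is the degree of each
    column. *)
Definition load p b : seq Y' -> nat :=
  count (fun y => (tag y == p) && (b \in entries y)).

Lemma cell_cat p i b s t : cell p i b (s ++ t) = cell p i b s + cell p i b t.
Proof. exact: count_cat. Qed.
Lemma height_cat p s t : height p (s ++ t) = height p s + height p t.
Proof. exact: count_cat. Qed.
Lemma load_cat p b s t : load p b (s ++ t) = load p b s + load p b t.
Proof. exact: count_cat. Qed.

Lemma load_cell p b s : load p b s = \sum_(i < k p) cell p i b s.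
Proof.
rewrite /load /cell; elim: s => [|y s IH] /=; first by rewrite big1.
rewrite big_split /= IH; congr addn; rewrite /has_entry.
case: eqP => [<-|_]; last by rewrite big1.
rewrite -(count_uniq_mem b (uniq_entries y)) -size_entries /=.
rewrite -sum1_count (big_nth 0) big_mkord big_mkcond; apply: eq_bigr => i _ /=; by case: (_ == b).
Qed.

Lemma load_le_height p b s : load p b s <= height p s.
Proof. by apply: sub_count => y /andP[]. Qed.

(** The heights are recorded as well because pi does not see the rows of length
    0; with them, equivalent lists have the same size. *)
Definition column_equiv (s t : seq Y') : Prop :=
  (forall p, height p s = height p t) /\
  (forall p (i : 'I_(k p)) b, cell p i b s = cell p i b t).

Lemma column_equiv_refl s : column_equiv s s. Proof. by []. Qed.
Lemma column_equiv_sym s t : column_equiv s t -> column_equiv t s.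
Proof. by case=> h1 h2; split=> *; rewrite ?h1 ?h2. Qed.
Lemma column_equiv_trans t s u :
  column_equiv s t -> column_equiv t u -> column_equiv s u.
Proof. by case=> h1 h2 [h3 h4]; split=> *; rewrite ?h1 ?h2. Qed.
Lemma column_equiv_cat s t s' t' :
  column_equiv s t -> column_equiv s' t' -> column_equiv (s ++ s') (t ++ t').
Proof.
by case=> h1 h2 [h3 h4]; split=> *; rewrite ?height_cat ?cell_cat ?h1 ?h2 ?h3 ?h4.
Qed.
Lemma column_equiv_cancel u s t :
  column_equiv (u ++ s) (u ++ t) -> column_equiv s t.
Proof.
case=> h1 h2; split=> [p|p i b]; first by have := h1 p; rewrite !height_cat; lia.
by have := h2 p i b; rewrite !cell_cat; lia.
Qed.
Lemma column_equiv_perm s t : perm_eq s t -> column_equiv s t.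
Proof. by move/seq.permP => h; split=> *; apply: h. Qed.

Lemma column_equiv_load s t p b : column_equiv s t -> load p b s = load p b t.
Proof. by case=> _ h; rewrite !load_cell; apply: eq_bigr => i _. Qed.

(** A multigraph whose left degrees are all d and whose right degrees are at most
    d splits into d matchings of all columns; each of them is a row with distinct
    entries. *)
Lemma rows_exist p d (E : seq ('I_(k p) * nat)) :
  (forall i, count (fun e => e.1 == i) E = d) ->
  (forall b, count (fun e => e.2 == b) E <= d) ->
  exists w : seq Y', [/\ all (fun y => tag y == p) w, size w = d &
    forall (i : 'I_(k p)) b, cell p i b w = count_mem (i, b) E].
Proof.
move=> El Er; have [||R [Rrow Rcnt Rfull]] := @koenig (k p) d E.
- by move=> i; rewrite El.
- exact: Er.
have RS c i : exists b, R c i = Some b.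
  have /eqP : #|[set c | R c i != None]| = #|'I_d| by rewrite Rfull El card_ord.
  move/eqP => h; have : c \in [set c | R c i != None].
    have /eqP -> : [set c | R c i != None] == [set: 'I_d].
      by rewrite eqEcard subsetT cardsT h; apply: leqnn.
    by rewrite in_setT.
  by rewrite inE; case: (R c i) => // b _; exists b.
pose r c i := odflt 0 (R c i).
have rE c i : R c i = Some (r c i) by rewrite /r; case: (RS c i) => b ->.
have rowex (c : 'I_d) : exists y : Y', tag y = p /\ entries y = [seq r c i | i <- enum 'I_(k p)].
  apply: varY'_exists; first by rewrite size_map size_enum_ord.
  rewrite map_inj_in_uniq ?enum_uniq // => i j _ _ rij.
  by apply: (Rrow c i j (r c i)); rewrite rE // rij.
pose row c := sval (constructive_indefinite_description _ (rowex c)).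
have rowP c : tag (row c) = p /\ entries (row c) = [seq r c i | i <- enum 'I_(k p)].
  by rewrite /row; case: constructive_indefinite_description.
exists (map row (enum 'I_d)); split.
- by rewrite all_map; apply/allP => c _ /=; rewrite (rowP c).1.
- by rewrite size_map size_enum_ord.
move=> i b; rewrite -Rcnt /cell count_map -sum1_count big_enum_cond -sum1_card.
apply: eq_bigl => c /=.
rewrite /has_entry (rowP c).1 eqxx (rowP c).2 inE rE /=.
by rewrite (nth_map i) ?size_enum_ord // nth_ord_enum.
Qed.

Definition edges p (s : seq Y') : seq ('I_(k p) * nat) :=
  flatten [seq [seq (i, nth 0 (entries y) i) | i : 'I_(k p) <- enum 'I_(k p)]
          | y <- s & tag y == p].

Lemma count_edges p (P : pred ('I_(k p) * nat)) s :
  count P (edges p s) = \sum_(i < k p)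
    count (fun y => (tag y == p) && P (i, nth 0 (entries y) i)) s.
Proof.
rewrite /edges; elim: s => [|y s IH] /=; first by rewrite big1.
rewrite big_split /= -IH; case: eqP => _ /=; last by rewrite big1.
rewrite count_cat count_map -sum1_count big_mkcond /= big_enum /=.
by congr addn; apply: eq_bigr => i _; case: (P _).
Qed.

Lemma count_mem_edges p (i : 'I_(k p)) b s :
  count_mem (i, b) (edges p s) = cell p i b s.
Proof.
rewrite count_edges (bigD1 i) //= big1 => [|j /negbTE ji]; last first.
  rewrite (@eq_count _ _ pred0) ?count_pred0 // => y.
  by rewrite /= xpair_eqE ji andbF.
by rewrite addn0; apply: eq_count => y /=; rewrite xpair_eqE eqxx.
Qed.

Lemma count_edges_left p (i : 'I_(k p)) s :
  count (fun e => e.1 == i) (edges p s) = height p s.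
Proof.
rewrite count_edges (bigD1 i) //= big1 => [|j /negbTE ji]; last first.
  by rewrite (@eq_count _ _ pred0) ?count_pred0 // => y; rewrite /= ji andbF.
by rewrite addn0; apply: eq_count => y /=; rewrite eqxx andbT.
Qed.

Lemma count_edges_right p b s :
  count (fun e => e.2 == b) (edges p s) = load p b s.
Proof. by rewrite count_edges load_cell. Qed.

Lemma cofactor_type p (u v : seq Y') :
  (forall (i : 'I_(k p)) b, cell p i b v <= cell p i b u) ->
  (forall b, load p b u + height p v <= height p u + load p b v) ->
  height p v <= height p u ->
  exists w : seq Y', [/\ all (fun y => tag y == p) w,
     height p v + size w = height p u &
     forall (i : 'I_(k p)) b, cell p i b v + cell p i b w = cell p i b u].
Proof.
move=> hc hl hh.
have /count_subseqP [E' /perm_to_subseq [E uE] vE'] :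
    forall x, count_mem x (edges p v) <= count_mem x (edges p u).
  by case=> i b; rewrite !count_mem_edges.
have cE P : count P (edges p u) = count P (edges p v) + count P E.
  by rewrite (seq.permP uE) count_cat (seq.permP vE').
have [|| w [wp ws wE]] := @rows_exist p (height p u - height p v) E.
- by move=> i; rewrite -!(count_edges_left i) cE addKn.
- move=> b; have := cE (fun e => e.2 == b); have := hl b.
  rewrite !count_edges_right; move: (count _ E) => n; lia.
exists w; split=> //; first by rewrite ws; lia.
by move=> i b; rewrite wE -!count_mem_edges cE.
Qed.

Lemma fresh_value p (s : seq Y') : exists b, load p b s = 0.
Proof.
exists (index_bound entries s).
apply/eqP; rewrite -leqn0 leqNgt -has_count; apply/hasPn => y ys.
rewrite negb_and; apply/orP; right; apply/negP => /(index_boundP ys).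
by rewrite ltnn.
Qed.

(** Divisibility in the image of pi.  Besides the divisibility of the monomials,
    which is the first condition, the quotient must be a union of d matchings,
    where d is the difference of the heights: no right degree of the quotient may
    exceed d. *)
Lemma column_cofactor (u v : seq Y') :
  (forall p (i : 'I_(k p)) b, cell p i b v <= cell p i b u) ->
  (forall p b, load p b u + height p v <= height p u + load p b v) ->
  exists w, column_equiv u (v ++ w).
Proof.
move=> hc hl.
have hh p : height p v <= height p u.
  have [b] := fresh_value p (u ++ v); rewrite load_cat => h0.
  by move: h0 (hl p b) => /eqP; rewrite addn_eq0 => /andP[/eqP-> /eqP->]; rewrite addn0.
have ex p := cofactor_type (hc p) (hl p) (hh p).
pose f p := sval (constructive_indefinite_description _ (ex p)).
have fP p : [/\ all (fun y => tag y == p) (f p),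
     height p v + size (f p) = height p u &
     forall (i : 'I_(k p)) b, cell p i b v + cell p i b (f p) = cell p i b u].
  by rewrite /f; case: constructive_indefinite_description.
have cntE (P : pred Y') p : (forall y, P y -> tag y = p) ->
    count P (flatten (map f (enum 'I_N))) = count P (f p).
  move=> Pp; rewrite count_flatten -map_comp sumnE big_map big_enum /=.
  rewrite (bigD1 p) //= big1 ?addn0 // => q qp.
  rewrite (@eq_in_count _ _ pred0) ?count_pred0 // => y yq /=.
  apply/negP => /Pp yp; have [/allP /(_ _ yq) /eqP yq' _ _] := fP q.
  by rewrite -yp yq' eqxx in qp.
exists (flatten (map f (enum 'I_N))); split=> [p|p i b].
  have [/allP pp hp _] := fP p; rewrite height_cat -hp; congr addn.
  rewrite /height (cntE _ p) => [|y /eqP //].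
  by rewrite -size_filter (@eq_in_filter _ _ predT) ?filter_predT // => y /pp.
have [_ _ hp] := fP p; rewrite cell_cat -hp; congr addn.
by rewrite /cell (cntE _ p) => // y /andP[/eqP].
Qed.

End Columns.

Arguments entries {N k} y.

(** * Divisors of bounded size *)

Section BoundedDivisors.
Context (N : nat) (k : 'I_N -> nat).
Local Notation Y' := (varY' k).

Definition maxarity := \max_p k p.

Lemma arity_le p : k p <= maxarity.
Proof. exact: leq_bigmax. Qed.

Definition covering_size := (maxarity.+1 * maxarity.+1)%N.

Lemma load_lt_heightP p b (s : seq Y') :
  reflect (exists x, [/\ x \in s, tag x == p & b \notin entries x])
          (load p b s < height p s).
Proof.
apply: (iffP idP) => [|[x [xs xp xb]]].
  rewrite ltnNge => /negP h; apply: NNPP => h'; apply: h.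
  rewrite /load (@eq_in_count _ _ (fun y => tag y == p)) // => x xs.
  case: (boolP (tag x == p)) => //= xp; apply/negPn/negP => xb.
  by apply: h'; exists x.
rewrite /load /height (seq.permP (perm_to_rem xs)).
rewrite (seq.permP (perm_to_rem xs)) /= xp (negbTE xb) ltnS.
exact: load_le_height.
Qed.

Lemma sub_multiset (T : eqType) (A u : seq T) : {subset A <= u} -> uniq A ->
  exists v, perm_eq u (A ++ v).
Proof.
move=> Au uA; have /count_subseqP [A' /perm_to_subseq [v uv] AA'] :
    forall x, count_mem x A <= count_mem x u.
  move=> x; rewrite count_uniq_mem //; case: (boolP (x \in A)) => //= /Au.
  by rewrite -has_pred1 has_count.
by exists v; rewrite (permPl uv) perm_cat2r perm_sym.
Qed.

(** Let u be equivalent to y followed by other rows.  A part of u of bounded size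
    contains the row y in this sense as soon as (1) every entry of y occurs in its
    column, and (2) every value b outside y is avoided by some row, so that the
    load of b does not exceed the height minus one.  Choose one row x0, and for
    each column a row for (1).  The values outside y that occur in these rows are
    bounded in number, and (2) is achieved for them by one more row each; any
    other value is avoided by x0. *)
Lemma divisor_of_row (y : Y') (w u : seq Y') : column_equiv u (y :: w) ->
  exists u0 u1 w0, [/\ perm_eq u (u0 ++ u1), size u0 <= covering_size &
    column_equiv u0 (y :: w0)].
Proof.
move pE : (tag y) => p uyw.
have [x0 x0u x0p] : exists2 x, x \in u & tag x == p.
  by apply/hasP; rewrite has_count -/(height p u) uyw.1 /height /= pE eqxx.
have cover (i : 'I_(k p)) : exists x, x \in u /\ has_entry p i (nth 0 (entries y) i) x.
  have : has (has_entry p i (nth 0 (entries y) i)) u.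
    rewrite has_count -/(cell p i (nth 0 (entries y) i) u) uyw.2.
    by rewrite /cell /= {1}/has_entry pE !eqxx.
  by move=> /hasP [x xu h]; exists x.
have avoid b : exists x, b \notin entries y ->
    [/\ x \in u, tag x == p & b \notin entries x].
  case: (boolP (b \notin entries y)) => by_; last by exists x0.
  suff /load_lt_heightP [x ?] : load p b u < height p u by exists x.
  rewrite (column_equiv_load _ _ uyw) uyw.1 /load /height /= pE eqxx (negbTE by_) /=.
  rewrite add0n add1n ltnS; exact: load_le_height.
pose f i := sval (constructive_indefinite_description _ (cover i)).
have fP i : f i \in u /\ has_entry p i (nth 0 (entries y) i) (f i).
  by rewrite /f; case: constructive_indefinite_description.
have [g gP] := choice_nat avoid.
pose A := x0 :: [seq f i | i <- enum 'I_(k p)].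
have Au x : x \in A -> x \in u /\ tag x = p.
  rewrite inE => /predU1P[->|/mapP [i _ ->]]; first by split=> //; apply/eqP.
  by have [? /andP[/eqP ? _]] := fP i.
pose B := [seq g b | b <- flatten (map entries A) & b \notin entries y].
have Bu x : x \in B -> x \in u.
  by move=> /mapP [b]; rewrite mem_filter => /andP[/gP[]] h _ _ _ ->.
have u0size : size (undup (A ++ B)) <= covering_size.
  apply: leq_trans (size_undup _) _.
  have sA : size A = (k p).+1 by rewrite /= size_map size_enum_ord.
  apply: (@leq_trans ((k p).+1 * (k p).+1)); last by rewrite leq_mul // ltnS arity_le.
  rewrite size_cat sA mulSn leq_add2l size_map size_filter.
  apply: leq_trans (count_size _ _) _; rewrite size_flatten /shape -map_comp sumnE big_map.
  rewrite (eq_big_seq (fun=> k p)) => [|x xA]; last first.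
    by rewrite /= size_entries (Au _ xA).2.
  by rewrite big_const_seq count_predT iter_addn_0 sA mulnC.
have := mem_undup (A ++ B); have := undup_uniq (A ++ B).
move: u0size; move: (undup _) => u0 u0size u0uniq u0E.
have [u1 uu1] : exists u1, perm_eq u (u0 ++ u1).
  apply: sub_multiset u0uniq => x.
  by rewrite u0E mem_cat => /orP[/Au[]|/Bu].
have [w0 w0P] : exists w0, column_equiv u0 ([:: y] ++ w0).
  apply: column_cofactor => [p' i b|p' b].
    rewrite /cell /= addn0; case: (boolP (has_entry p' i b y)) => // /andP[/eqP yp' /eqP ib].
    have pp' : p = p' by rewrite -pE.
    case: p' / pp' i yp' ib => i _ ib.
    rewrite -has_count; apply/hasP; exists (f i); last by rewrite -ib; case: (fP i).
    by rewrite u0E mem_cat inE map_f ?orbT // mem_enum.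
  rewrite {2}/height {2}/load /= !addn0 pE.
  case: (altP (p =P p')) => [<-|_] /=; last by rewrite !addn0 load_le_height.
  case: (boolP (b \in entries y)) => yb; first by rewrite leq_add2r load_le_height.
  rewrite addn0 addn1; apply/load_lt_heightP.
  case: (boolP (b \in flatten (map entries A))) => bA.
    exists (g b); have [_ gp gb] := gP b yb; split=> //.
    by rewrite u0E mem_cat map_f ?orbT // mem_filter yb.
  exists x0; rewrite u0E mem_cat inE eqxx; split=> //.
  by apply: contra bA => bx0; apply/flattenP; exists (entries x0); rewrite //= inE eqxx.
by exists u0, u1, w0.
Qed.

(** The elements of u needed to complete w to a multiset containing v0 form a part
    c1 of u that is not larger than v0. *)
Lemma perm_split (T : eqType) (w u v0 v1 : seq T) :
  perm_eq (w ++ u) (v0 ++ v1) -> exists c1 c2 v2,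
    [/\ perm_eq u (c1 ++ c2), perm_eq (w ++ c1) (v0 ++ v2) & size c1 <= size v0].
Proof.
elim: v0 w u => [|x v0 IH] w u h.
  by exists [::], u, w; rewrite cats0 /=; split.
have : x \in w ++ u by rewrite (perm_mem h) inE eqxx.
rewrite mem_cat; case: (boolP (x \in w)) => [xw _|_ /= xu].
  have pw := perm_to_rem xw.
  have [|c1 [c2 [v2 [h1 h2 h3]]]] := IH (rem x w) u.
    rewrite -(perm_cons x); apply: perm_trans h.
    by rewrite -cat_cons perm_cat2r perm_sym.
  exists c1, c2, v2; split=> //; last exact: leqW.
  by rewrite /= (permPl (perm_cat pw (perm_refl c1))) /= perm_cons.
have pu := perm_to_rem xu.
have [|c1 [c2 [v2 [h1 h2 h3]]]] := IH w (rem x u).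
  rewrite -(perm_cons x); apply: perm_trans h.
  by rewrite -cat1s perm_catCA perm_cat2l cat1s perm_sym.
exists (x :: c1), c2, v2; split=> //.
  by rewrite (permPl pu) /= perm_cons.
by rewrite -cat1s perm_catCA /= perm_cons.
Qed.

(** The rows of q are split off one after the other; equivalence is cancellative,
    so each one is found in a bounded part of what the previous ones left. *)
Lemma divisor_of_rows (q w u : seq Y') : column_equiv u (q ++ w) ->
  exists u0 u1 w0, [/\ perm_eq u (u0 ++ u1), size u0 <= covering_size * size q &
    column_equiv u0 (q ++ w0)].
Proof.
elim: q w u => [|y q IH] w u uqw.
  by exists [::], u, [::]; split.
have [u0 [u1 [w0 [pu su u0w0]]]] := divisor_of_row uqw.
have : column_equiv (w0 ++ u1) (q ++ w).
  apply: (@column_equiv_cancel _ _ [:: y]); rewrite catA.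
  apply: column_equiv_trans (column_equiv_sym _) uqw.
  apply: column_equiv_trans (column_equiv_perm pu) _.
  by apply: column_equiv_cat.
move=> /IH [v0 [v1 [r0 [pv sv v0r0]]]].
have [c1 [c2 [v2 [h1 h2 h3]]]] := perm_split pv.
exists (u0 ++ c1), c2, (r0 ++ v2); split.
- by rewrite (permPl pu) -catA perm_cat2l.
- by rewrite size_cat mulnS leq_add // (leq_trans h3).
apply: column_equiv_trans (column_equiv_cat u0w0 (column_equiv_refl c1)) _.
apply: (@column_equiv_cat _ _ [:: y] [:: y] (w0 ++ c1) (q ++ r0 ++ v2)) => //.
apply: column_equiv_trans (column_equiv_perm h2) _.
by rewrite catA; apply: column_equiv_cat.
Qed.

End BoundedDivisors.

(** * Well-quasi-ordering of the image of pi *)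

Lemma in_Inc_inj rho : in_Inc rho -> injective rho.
Proof.
move=> rhoI a b ab; case: (ltngtP a b) => // /rhoI; by rewrite ab ltnn.
Qed.

(** If F is dominated by G along rho and the total of G is not larger than the
    total of F, then nothing is left for G outside the image of rho. *)
Lemma sum_gap (F G : nat -> nat) m n rho : in_Inc rho ->
  (forall a, a < m -> rho a < n /\ F a <= G (rho a)) ->
  \sum_(b < n) G b <= \sum_(a < m) F a ->
  forall b, b < n -> (forall a, a < m -> rho a <> b) -> G b = 0.
Proof.
move=> rhoI FG sumGF b bn brho.
have [||v vP] := @sub_multiset _ (b :: map rho (iota 0 m)) (iota 0 n).
- move=> c; rewrite inE => /predU1P[->|/mapP[a]]; rewrite !mem_iota //= !add0n.
  by move=> /FG[? _] ->.
- rewrite /= map_inj_uniq ?iota_uniq ?andbT; last exact: in_Inc_inj.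
  by apply/mapP => -[a]; rewrite mem_iota /= add0n => /brho nb ab; apply: nb.
move: sumGF; rewrite -!(big_mkord xpredT) /index_iota !subn0 (perm_big _ vP) /=.
rewrite big_cons big_cat big_map /=.
suff : \sum_(a <- iota 0 m) F a <= \sum_(a <- iota 0 m) G (rho a).
  move: (\sum_(_ <- _) F _) (\sum_(_ <- iota 0 m) G _) (\sum_(_ <- v) _); lia.
rewrite !big_seq; apply: leq_sum => a; rewrite mem_iota /= add0n => /FG[] //.
Qed.

Section WordOrder.
Context (N : nat) (k : 'I_N -> nat).
Local Notation Y' := (varY' k).

Lemma sum_cell p (i : 'I_(k p)) (u : seq Y') n :
  (forall y a, y \in u -> a \in entries y -> a < n) ->
  \sum_(b < n) cell p i b u = height p u.
Proof.
elim: u => [|y u IH] un; first by rewrite big1.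
rewrite /cell /height /= big_split /= -/(height p u) -IH; last first.
  by move=> z a zu; apply: un; rewrite inE zu orbT.
congr addn; rewrite /has_entry; case: eqP => [yp|_]; last by rewrite big1.
have h : nth 0 (entries y) i < n.
  by apply: (un y); rewrite ?mem_head // mem_nth // size_entries yp.
rewrite (bigD1 (Ordinal h)) //= eqxx big1 // => b.
by rewrite -val_eqE /= eq_sym => /negbTE ->.
Qed.

Lemma sum_load p (u : seq Y') n :
  (forall y a, y \in u -> a \in entries y -> a < n) ->
  \sum_(b < n) load p b u = k p * height p u.
Proof.
move=> un; under eq_bigr => b _ do rewrite load_cell.
rewrite exchange_big /=; under eq_bigr => i _ do rewrite sum_cell //.
by rewrite sum_nat_const card_ord.
Qed.

(** More than half of the rows of type p contain b.  There are at most 2 k_p such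
    values, since the loads add up to k_p times the height. *)
Definition heavy p b (u : seq Y') : nat := height p u < (load p b u).*2.
Definition heavy_count p (u : seq Y') := \sum_(b < index_bound entries u) heavy p b u.

Lemma heavy_count_le p u : heavy_count p u <= maxarity k * 2.
Proof.
case: (posnP (height p u)) => hp.
  rewrite /heavy_count big1 // => b _; rewrite /heavy.
  by have := load_le_height p b u; rewrite hp leqn0 => /eqP ->.
rewrite -(leq_pmul2r hp) /heavy_count big_distrl /=.
apply: (@leq_trans (\sum_(b < index_bound entries u) (load p b u * 2))).
  apply: leq_sum => b _; rewrite /heavy.
  by case: ltnP; rewrite ?mul0n // mul1n muln2 => /ltnW.
rewrite -big_distrl /= sum_load; last by move=> y a; apply: index_boundP.
have := arity_le k p; nia.
Qed.

(** The letter at b records the number of occurrences of b in each column, the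
    number of rows of each type that avoid b, and for which types b is heavy. *)
Definition letter_index : finType := ('I_N * ('I_(maxarity k) + bool))%type.

Definition letter (u : seq Y') (b : nat) (c : letter_index) : nat :=
  match c with
  | (p, inl i) => cell p i b u
  | (p, inr true) => heavy p b u
  | (p, inr false) => height p u - load p b u
  end.

Definition word (u : seq Y') := [seq letter u b | b <- iota 0 (index_bound entries u)].

(** Since the number of heavy values is at most twice [maxarity], the second
    condition compares these numbers in the opposite direction, by means of a
    well-quasi-order.  An embedding of words injects heavy values into heavy
    values, so it is then a bijection between them. *)
Definition word_le (v u : seq Y') : Prop :=
  (forall p, eq_or_double (height p v) (height p u)) /\
  ((forall p, maxarity k * 2 - heavy_count p v <= maxarity k * 2 - heavy_count p u) /\
   embeds (fun x y : letter_index -> nat => forall c, x c <= y c) (word v) (word u)).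

Lemma good_word_le : good word_le.
Proof.
apply: good_and.
- by move=> y x z xy yz p; apply: eq_or_double_trans (xy p) (yz p).
- apply: (@good_preimage _ _ (fun u p => height p u)
    (fun x y => forall p, eq_or_double (x p) (y p))).
  exact: good_forall eq_or_double_trans good_eq_or_double.
apply: good_and.
- by move=> y x z xy yz p; apply: leq_trans (xy p) (yz p).
- apply: (@good_preimage _ _ (fun u p => maxarity k * 2 - heavy_count p u)
    (fun x y => forall p, x p <= y p)).
  exact: good_leq_fun.
apply: (@good_preimage _ _ word); apply: higman; first exact: leq_fun_trans.
exact: good_leq_fun.
Qed.

Lemma entries_agree s rho (v : seq Y') y : agrees entries s rho v -> y \in v ->
  entries (actY' s y) = map rho (entries y).
Proof. by move=> sr yv; apply/eq_in_map => b; apply: sr. Qed.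

Section Act.
Context (s : finperm) (rho : nat -> nat) (v : seq Y').
Hypotheses (rhoI : in_Inc rho) (sr : agrees entries s rho v).

Lemma height_act p : height p (map (actY' s) v) = height p v.
Proof. by rewrite /height count_map. Qed.

Lemma has_entry_act p (i : 'I_(k p)) b y : y \in v ->
  has_entry p i b (actY' s y) = (tag y == p) && (rho (nth 0 (entries y) i) == b).
Proof.
move=> yv; rewrite /has_entry (entries_agree sr yv) /=; case: eqP => //= yp.
by rewrite (nth_map 0) // size_entries yp.
Qed.

Lemma cell_act p (i : 'I_(k p)) b :
  cell p i (rho b) (map (actY' s) v) = cell p i b v.
Proof.
rewrite /cell count_map; apply: eq_in_count => y yv /=.
by rewrite has_entry_act // (inj_eq (in_Inc_inj rhoI)).
Qed.

Lemma cell_act0 p (i : 'I_(k p)) b :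
  (forall a, a < index_bound entries v -> rho a <> b) -> cell p i b (map (actY' s) v) = 0.
Proof.
move=> hb; rewrite /cell count_map -[RHS](count_pred0 v); apply: eq_in_count => y yv /=.
rewrite has_entry_act //; apply/negP => /andP[/eqP yp /eqP]; apply: hb.
by apply: index_boundP yv _; rewrite mem_nth // size_entries yp.
Qed.

End Act.

(** Divisibility up to Inc(N) in the image of pi.  The action of rho is expressed
    by all the permutations s that agree with rho on the indices that matter;
    such s exist because rho is injective. *)
Definition Inc_divides (v u : seq Y') : Prop :=
  exists rho, in_Inc rho /\ forall s, agrees entries s rho v ->
    exists w, column_equiv u (map (actY' s) v ++ w).

Lemma Inc_divides_refl u : Inc_divides u u.
Proof.
exists id; split=> // s sr; exists [::]; rewrite cats0.
suff -> : map (actY' s) u = u by [].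
rewrite -[RHS]map_id; apply/eq_in_map => y yu; apply: varY'_eq => //.
by rewrite (entries_agree sr yu) map_id.
Qed.

(** By [column_cofactor], it has to be shown that for each value b the load of b
    in u exceeds the load in the image of v by at most the difference of the
    heights.  For b in the image of rho this is the inequality between the numbers
    of rows avoiding b.  For b outside the image, b has load 0 in the image of v.
    If the heights agree, all entries of u of type p are used up by the embedding,
    so the load of b in u is 0.  Otherwise the height of u is at least twice that
    of v, and b is not heavy in u, because all heavy values are in the image. *)
Lemma word_le_Inc_divides v u : word_le v u -> Inc_divides v u.
Proof.
case=> hh [hc /(embeds_index (fun=> 0)) [rho [rhoI rhoP]]].
exists rho; split=> // s sr.
have {}rhoP a : a < index_bound entries v -> rho a < index_bound entries u /\
    forall c, letter v a c <= letter u (rho a) c.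
  move=> av; have := rhoP a; rewrite !size_map !size_iota => /(_ av) [ru le].
  split=> // c; have := le c.
  by rewrite !(nth_map 0) ?size_iota // !nth_iota.
have cellP p (i : 'I_(k p)) a : a < index_bound entries v -> cell p i a v <= cell p i (rho a) u.
  by move=> /rhoP[_ /(_ (p, inl (widen_ord (arity_le k p) i)))].
have load0 p b : (forall a, a < index_bound entries v -> rho a <> b) ->
    load p b (map (actY' s) v) = 0.
  by move=> hb; rewrite load_cell big1 // => i _; rewrite (cell_act0 sr).
have load_out p b : index_bound entries u <= b -> load p b u = 0.
  move=> ub; apply/eqP; rewrite -leqn0 leqNgt -has_count; apply/hasPn => y yu.
  rewrite negb_and; apply/orP; right; apply/negP => /(index_boundP yu).
  by rewrite ltnNge ub.
apply: column_cofactor => [p i b|p b].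
  case: (classic (exists2 a, a < index_bound entries v & rho a = b)) => [[a av <-]|h].
    by rewrite (cell_act rhoI sr) cellP.
  by rewrite (cell_act0 sr) // => a av ab; apply: h; exists a.
rewrite height_act.
case: (classic (exists2 a, a < index_bound entries v & rho a = b)) => [[a av <-]|h].
  have -> : load p (rho a) (map (actY' s) v) = load p a v.
    by rewrite !load_cell; apply: eq_bigr => i _; rewrite (cell_act rhoI sr).
  have [_ /(_ (p, inr false))] := rhoP a av; rewrite /letter.
  have := load_le_height p a v; have := load_le_height p (rho a) u.
  by case: (hh p); lia.
have {}h a : a < index_bound entries v -> rho a <> b by move=> av ab; apply: h; exists a.
rewrite load0 // addn0.
case: (leqP (index_bound entries u) b) => bu.
  rewrite load_out // add0n; case: (hh p) => [->//|]; rewrite -addnn.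
  by apply: leq_trans; rewrite leq_addr.
case: (hh p) => [hvu|h2].
  suff -> : load p b u = 0 by rewrite hvu.
  rewrite load_cell big1 // => i _.
  apply: (@sum_gap (fun a => cell p i a v) (fun b => cell p i b u) _ _ rho) bu h => //.
    by move=> a av; split; [have [] := rhoP a av | apply: cellP].
  by rewrite !sum_cell ?hvu // => y a; apply: index_boundP.
have : heavy p b u = 0.
  apply: (@sum_gap (fun a => heavy p a v) (fun b => heavy p b u) _ _ rho) bu h => //.
    by move=> a av; have [? /(_ (p, inr true))] := rhoP a av.
  have := hc p; have := heavy_count_le p u; have := heavy_count_le p v.
  rewrite /heavy_count; lia.
rewrite /heavy; case: ltnP => // h3 _; lia.
Qed.

Lemma good_Inc_divides : good Inc_divides.
Proof. exact: good_sub word_le_Inc_divides good_word_le. Qed.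

End WordOrder.

(** * Lists of bounded size *)

Lemma eq_onth (T : Type) (s t : seq T) : onth s =1 onth t -> s = t.
Proof.
elim: s t => [|x s IH] [|y t] // h; try by have := h 0.
by have [->] := h 0; congr cons; apply: IH => r; have := h r.+1.
Qed.

Lemma onth_some (T : eqType) (s : seq T) r y :
  onth s r = Some y -> y \in s /\ r < size s.
Proof.
elim: s r => [|x s IH] [|r] //=; first by move=> [->]; rewrite mem_head.
by move/IH => [ys rs]; rewrite inE ys orbT.
Qed.

Lemma onth_none (T : eqType) (s : seq T) r : (onth s r == None) = (size s <= r).
Proof. by elim: s r => [|x s IH] [|r] //=; rewrite IH. Qed.

Section BoundedSize.
Context (N : nat) (k : 'I_N -> nat) (C : nat).
Local Notation Y' := (varY' k).

Definition Inc_image (v u : seq Y') : Prop :=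
  exists rho, in_Inc rho /\ forall s, agrees entries s rho v -> u = map (actY' s) v.

Lemma Inc_image_refl u : Inc_image u u.
Proof.
exists id; split=> // s sr; rewrite -[LHS]map_id; apply/eq_in_map => y yu.
by apply: varY'_eq => //; rewrite (entries_agree sr yu) map_id.
Qed.

(** A list of at most C variables is a word over a finite alphabet: the letter at
    b records the places (list position, column) at which b occurs. *)
(** The first two conditions together say that the types agree. *)
Definition slot_letter (u : seq Y') (b : nat) (c : 'I_C * 'I_(maxarity k)) : nat :=
  if onth u c.1 is Some y
  then (c.2 < k (tag y)) && (nth 0 (entries y) c.2 == b) else false.

(** Positions beyond the end of the list get the value 0, which distinguishes
    lists of different sizes. *)
Definition slot_type (u : seq Y') (r : 'I_C) : nat :=
  if onth u r is Some y then (tag y).+1 else 0.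

Definition slot_word (u : seq Y') :=
  [seq slot_letter u b | b <- iota 0 (index_bound entries u)].

Definition slot_le (v u : seq Y') : Prop :=
  (forall r, slot_type v r <= slot_type u r) /\
  ((forall r, N - slot_type v r <= N - slot_type u r) /\
   embeds (fun x y : 'I_C * 'I_(maxarity k) -> nat => forall c, x c <= y c)
     (slot_word v) (slot_word u)).

Lemma good_slot_le : good slot_le.
Proof.
apply: good_and.
- by move=> y x z xy yz p; apply: leq_trans (xy p) (yz p).
- apply: (@good_preimage _ _ slot_type (fun x y => forall p, x p <= y p)).
  exact: good_leq_fun.
apply: good_and.
- by move=> y x z xy yz p; apply: leq_trans (xy p) (yz p).
- apply: (@good_preimage _ _ (fun u p => N - slot_type u p)
    (fun x y => forall p, x p <= y p)).
  exact: good_leq_fun.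
apply: (@good_preimage _ _ slot_word); apply: higman; first exact: leq_fun_trans.
exact: good_leq_fun.
Qed.

Lemma slot_le_Inc_image v u :
  size v <= C -> size u <= C -> slot_le v u -> Inc_image v u.
Proof.
move=> vC uC [h1 [h2 /(embeds_index (fun=> 0)) [rho [rhoI rhoP]]]].
exists rho; split=> // s sr.
have typeN w r : slot_type w r <= N.
  by rewrite /slot_type; case: (onth w r) => // y; apply: ltn_ord.
have types r : slot_type u r = slot_type v r.
  have := h1 r; have := h2 r; have := typeN u r; have := typeN v r; lia.
have {}rhoP a : a < index_bound entries v ->
    forall c, slot_letter v a c <= slot_letter u (rho a) c.
  move=> av; have := rhoP a; rewrite !size_map !size_iota => /(_ av) [ru le] c.
  by have := le c; rewrite !(nth_map 0) ?size_iota // !nth_iota.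
apply: eq_onth => r; rewrite onth_map.
case: (ltnP r C) => [rC|Cr]; last first.
  have /eqP -> : onth u r == None by rewrite onth_none (leq_trans uC).
  by have /eqP -> : onth v r == None by rewrite onth_none (leq_trans vC).
have := types (Ordinal rC); rewrite /slot_type /=.
case ur : (onth u r) => [y'|]; case vr : (onth v r) => [y|] //= [/val_inj tt].
have [yv _] := onth_some vr.
congr Some; apply: varY'_eq; rewrite ?tt // (entries_agree sr yv).
apply: (@eq_from_nth _ 0); rewrite ?size_map !size_entries ?tt // => i iy.
rewrite (nth_map 0) ?size_entries //.
have bv : nth 0 (entries y) i < index_bound entries v.
  by apply: index_boundP yv _; rewrite mem_nth ?size_entries.
have iK : i < maxarity k by apply: leq_trans iy (arity_le k _).
have := rhoP _ bv (Ordinal rC, Ordinal iK).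
by rewrite /slot_letter /= ur vr tt iy eqxx /=; case: eqP.
Qed.

Lemma bounded_size_basis (S : seq Y' -> Prop) : (forall u, S u -> size u <= C) ->
  exists F : seq (seq Y'), (forall v, v \in F -> S v) /\
    forall u, S u -> exists2 v, v \in F & Inc_image v u.
Proof.
move=> SC.
have [||F [FS FP]] := @good_finite_basis (seq Y')
    (fun v u => size v <= C -> size u <= C -> Inc_image v u) S.
- by move=> u _ _; apply: Inc_image_refl.
- by apply: good_sub good_slot_le => v u vu vC uC; apply: slot_le_Inc_image.
exists F; split=> // u Su; have [v vF vu] := FP u Su.
by exists v => //; apply: vu; apply: SC => //; apply: FS.
Qed.

End BoundedSize.

(** * Monomials as products of lists of variables *)

Section MonomialProducts.
Context (V : choiceType).

Lemma cmonom_eqP (a b : {cmonom V}) : (forall v, a v = b v) -> a = b.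
Proof. by move=> h; apply/eqP/cmP. Qed.

Definition mprod (s : seq V) : {cmonom V} := \big[mmul/mone]_(v <- s) monvar v.

Lemma mprod0 : mprod [::] = mone.
Proof. exact: big_nil. Qed.

Lemma mprod_cons v s : mprod (v :: s) = mmul (monvar v) (mprod s).
Proof. exact: big_cons. Qed.

Lemma mprod_cat s t : mprod (s ++ t) = mmul (mprod s) (mprod t).
Proof. exact: big_cat. Qed.

Lemma mprod1 v : mprod [:: v] = monvar v.
Proof. exact: big_seq1. Qed.

Lemma mprodE s v : mprod s v = count_mem v s.
Proof.
elim: s => [|w s IH]; first by rewrite /mprod big_nil cm1.
by rewrite mprod_cons cmM cmU IH.
Qed.

Lemma mdeg_mprod s : mdeg (mprod s) = size s.
Proof.
elim: s => [|w s IH]; first by rewrite /mprod big_nil mdeg1.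
by rewrite mprod_cons mdegM mdegU IH.
Qed.

Lemma mprod_eq s t : mprod s = mprod t <-> perm_eq s t.
Proof.
split=> [h|/seq.permP h]; last by apply: cmonom_eqP => v; rewrite !mprodE h.
by apply/allP => v _ /=; rewrite -!mprodE h.
Qed.

Lemma mprod_surj a : exists s, a = mprod s.
Proof.
exists (flatten [seq nseq (a v) v | v <- finsupp a]).
apply: cmonom_eqP => v; rewrite mprodE count_flatten -map_comp sumnE big_map.
rewrite (eq_bigr (fun w => (w == v) * a w)%N) => [|w _]; last first.
  by rewrite /= count_nseq /=.
case: (boolP (v \in finsupp a)) => va.
  rewrite (bigD1_seq v) //= eqxx mul1n big1 ?addn0 //.
  by move=> w /negbTE ->.
rewrite big_seq big1 => [|w wa]; first by apply/eqP; rewrite cmE_eq0.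
by case: eqP => // wv; rewrite -wv wa in va.
Qed.

Lemma mprod_cofactor s t : (forall v, mprod s v <= mprod t v)%N ->
  exists r, perm_eq t (s ++ r).
Proof.
move=> h; have /count_subseqP [s' /perm_to_subseq [r tr] ss'] :
    forall x, (count_mem x s <= count_mem x t)%N by move=> x; rewrite -!mprodE.
by exists r; rewrite (permPl tr) perm_cat2r perm_sym.
Qed.

Lemma monvar_inj (v w : V) : monvar v = monvar w -> v = w.
Proof. by move=> /(congr1 (fun m : {cmonom V} => m w)); rewrite cmUU cmU; case: eqP. Qed.

End MonomialProducts.

Lemma expcmnE (W : choiceType) (m : {cmonom W}) n w : expcmn m n w = (n * m w)%N.
Proof.
rewrite /expcmn -[iterop _ _ _ _]/(iterop n mmul m mone) Monoid.iteropE.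
by elim: n => [|n IH] /=; rewrite ?cm1 // cmM IH mulSn.
Qed.

Section MonExt.
Context (V W : choiceType) (f : V -> {cmonom W}).

Lemma big_mmulE (I : Type) (r : seq I) (F : I -> {cmonom W}) w :
  (\big[mmul/mone]_(i <- r) F i) w = (\sum_(i <- r) F i w)%N.
Proof. by elim: r => [|i r IH]; rewrite ?big_nil ?cm1 // !big_cons cmM IH. Qed.

Lemma mon_ext_mprod s : mon_ext f (mprod s) = \big[mmul/mone]_(v <- s) f v.
Proof.
apply: cmonom_eqP => w; rewrite /mon_ext !big_mmulE.
rewrite (eq_bigr (fun v => count_mem v s * f v w)%N) => [|v _]; last first.
  by rewrite expcmnE mprodE.
have h : finsupp (mprod s) =i s.
  by move=> v; rewrite -cmE_neq0 mprodE -lt0n -has_count has_pred1.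
rewrite (perm_big (undup s)) /=; last first.
  by apply: uniq_perm => //; rewrite ?undup_uniq // => v; rewrite h mem_undup.
rewrite -[RHS]big_undup_iterop_count; apply: eq_bigr => v _.
by rewrite Monoid.iteropE [RHS]iter_addn_0 mulnC.
Qed.

Lemma mon_ext1 : mon_ext f mone = mone.
Proof. by rewrite -mprod0 mon_ext_mprod big_nil. Qed.

Lemma mon_extU v : mon_ext f (monvar v) = f v.
Proof. by rewrite -mprod1 mon_ext_mprod big_seq1. Qed.

Lemma mon_extM a b : mon_ext f (mmul a b) = mmul (mon_ext f a) (mon_ext f b).
Proof.
have [s ->] := mprod_surj a; have [t ->] := mprod_surj b.
by rewrite -mprod_cat !mon_ext_mprod big_cat.
Qed.

End MonExt.

Lemma mon_ext_comp (U V W : choiceType) (f : V -> {cmonom W}) (g : U -> {cmonom V}) m :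
  mon_ext f (mon_ext g m) = mon_ext (fun v => mon_ext f (g v)) m.
Proof.
have [s ->] := mprod_surj m; elim: s => [|v s IH].
  by rewrite mprod0 !mon_ext1.
by rewrite mprod_cons !mon_extM !mon_extU IH.
Qed.

Lemma eq_mon_ext (V W : choiceType) (f g : V -> {cmonom W}) m :
  f =1 g -> mon_ext f m = mon_ext g m.
Proof.
move=> fg; have [s ->] := mprod_surj m; rewrite !mon_ext_mprod.
exact: eq_bigr.
Qed.

Lemma mon_ext_var (V W : choiceType) (f : V -> W) s :
  mon_ext (fun v => monvar (f v)) (mprod s) = mprod (map f s).
Proof. by rewrite mon_ext_mprod /mprod big_map. Qed.

Lemma mon_act_mprod (V : choiceType) (act : finperm -> V -> V) g s :
  mon_act act g (mprod s) = mprod (map (act g) s).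
Proof. exact: mon_ext_var. Qed.

(** * Finite permutations *)

Lemma finperm_eqP (s t : finperm) : s =1 t -> s = t.
Proof.
case: s t => [f fi] [g gi] /= fg.
have e : f = g by apply/fsfunP.
by rewrite e in fi *; congr FinPerm; apply: bool_irrelevance.
Qed.

Lemma finperm1E i : finperm1 i = i.
Proof. exact: fsfun0E. Qed.

Lemma finpermME s t i : finpermM s t i = s (t i).
Proof. by rewrite /= fscompE. Qed.

Lemma transp_subproof (a b : nat) :
  fsinjectiveb [fsfun i in [fset a; b]%fset => if i == a then b else a].
Proof.
apply/fsinjectiveP => i j; rewrite !fsfunE !inE.
by case: (i =P a); case: (j =P a); case: (i =P b); case: (j =P b) => /=; lia.
Qed.

Definition transp (a b : nat) : finperm := FinPerm (transp_subproof a b).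

Lemma transpE a b i :
  transp a b i = if i == a then b else if i == b then a else i.
Proof. by rewrite /= fsfunE !inE; case: eqP => //=; case: eqP. Qed.

Lemma finperm_support (s : finperm) : exists n, forall i, (n <= i)%N -> s i = i.
Proof.
exists (\max_(i <- finsupp s) i).+1 => i ni; case: finsuppP => // h.
have := @leq_bigmax_seq nat (enum_fset (finsupp s)) predT (fun i : nat => i) i h isT.
by rewrite leqNgt ni.
Qed.

Lemma finperm_stable (s : finperm) n i :
  (forall i, (n <= i)%N -> s i = i) -> (i < n)%N -> (s i < n)%N.
Proof.
move=> sn lt_in; rewrite ltnNge; apply/negP => le_n.
by have /finperm_inj e := sn _ le_n; rewrite e leqNgt lt_in in le_n.
Qed.

(** One value is corrected at a time by composing with a transposition. *)
Lemma finperm_extension_bound n m (f : nat -> nat) : (n <= m)%N ->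
  (forall i, (i < n)%N -> (f i < m)%N) ->
  (forall i j, (i < n)%N -> (j < n)%N -> f i = f j -> i = j) ->
  exists s : finperm, (forall i, (i < n)%N -> s i = f i) /\
    forall i, (m <= i)%N -> s i = i.
Proof.
elim: n => [|n IH] nm fm finj.
  by exists finperm1; split=> // i _; apply: finperm1E.
have [||i j|s [sP sm]] := IH; first exact: ltnW.
- by move=> i lt_in; apply: fm; apply: ltnW.
- by move=> /ltnW ? /ltnW ?; apply: finj.
exists (finpermM (transp (s n) (f n)) s); split=> i; rewrite finpermME transpE.
  rewrite ltnS leq_eqVlt => /predU1P[->|lt_in]; first by rewrite eqxx.
  rewrite (inj_eq (@finperm_inj s)) ltn_eqF // sP //.
  case: eqP => // fin; have e := finj i n (leqW lt_in) (ltnSn n) fin.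
  by rewrite e ltnn in lt_in.
move=> mi; rewrite sm //.
have sn := finperm_stable sm nm; have fn := fm n (ltnSn n).
by rewrite !gtn_eqF // (leq_trans _ mi).
Qed.

Lemma finperm_extension n (f : nat -> nat) :
  (forall i j, (i < n)%N -> (j < n)%N -> f i = f j -> i = j) ->
  exists s : finperm, forall i, (i < n)%N -> s i = f i.
Proof.
move=> finj; pose m := (n + (\max_(i < n) f i).+1)%N.
have [||s [sP _]] := @finperm_extension_bound n m f _ _ finj; last by exists s.
  exact: leq_addr.
move=> i lt_in; rewrite /m addnS ltnS; apply: leq_trans (leq_addl _ _).
exact: (@leq_bigmax _ (fun i : 'I_n => f i) (Ordinal lt_in)).
Qed.

Lemma finperm_inverse (s : finperm) :
  exists t, finpermM t s = finperm1 /\ finpermM s t = finperm1.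
Proof.
have [n sn] := finperm_support s.
pose g (i : 'I_n) := Ordinal (finperm_stable sn (ltn_ord i)).
have g_inj : injective g.
  by move=> i j /(congr1 val) /= /finperm_inj /val_inj.
pose f i := if insub i is Some i' then val (invF g_inj i') else i.
have fE (i : 'I_n) : f i = invF g_inj i by rewrite /f valK.
have [||t [tP tn]] := @finperm_extension_bound n n f (leqnn n).
- by move=> i lt_in; rewrite -[i]/(val (Ordinal lt_in)) fE.
- move=> i j hi hj; rewrite -[i]/(val (Ordinal hi)) -[j]/(val (Ordinal hj)) !fE.
  by move=> /val_inj /(can_inj (f_invF g_inj)) ->.
exists t; split; apply: finperm_eqP => i; rewrite finpermME finperm1E.
  case: (ltnP i n) => lt_in; last by rewrite sn // tn.
  have sin := finperm_stable sn lt_in.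
  rewrite tP // -[s i]/(val (g (Ordinal lt_in))) fE.
  by rewrite invF_f.
case: (ltnP i n) => lt_in; last by rewrite tn // sn.
rewrite tP // -[i]/(val (Ordinal lt_in)) fE.
by rewrite -[LHS]/(val (g (invF g_inj (Ordinal lt_in)))) f_invF.
Qed.

Lemma finperm_of_Inc rho n : in_Inc rho ->
  exists s : finperm, forall i, (i < n)%N -> s i = rho i.
Proof.
by move=> rhoI; apply: finperm_extension => i j _ _; apply: in_Inc_inj.
Qed.

Section Actions.
Context (T : Type) (act : finperm -> T -> T) (actP : is_action act).

Lemma act_inj s : injective (act s).
Proof.
have [t [ts _]] := finperm_inverse s => x y xy.
by rewrite -(actP.1 x) -(actP.1 y) -ts !actP.2 xy.
Qed.

Lemma act_surj s y : exists x, act s x = y.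
Proof.
by have [t [_ st]] := finperm_inverse s; exists (act t y); rewrite -actP.2 st actP.1.
Qed.

Lemma act_eq_of_fixed n x (s t : finperm) : fixed_above act n x ->
  (forall i, (i < n)%N -> s i = t i) -> act s x = act t x.
Proof.
move=> fx st; have [t' [t't tt']] := finperm_inverse t.
have : act (finpermM t' s) x = x.
  by apply: fx => i /st e; rewrite finpermME e -finpermME t't finperm1E.
by rewrite actP.2 => {2}<-; rewrite -actP.2 tt' actP.1.
Qed.

Lemma has_width_exists n x : fixed_above act n x ->
  exists2 m, has_width act x m & (m <= n)%N.
Proof.
elim/ltn_ind: n => n IH fx.
case: (classic (exists2 m, (m < n)%N & fixed_above act m x)) => [[m mn /IH]|h].
  by move=> /(_ mn)[m' ? m'm]; exists m' => //; apply: leq_trans m'm (ltnW mn).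
exists n => //; split=> // m fm; rewrite leqNgt; apply/negP => mn.
by apply: h; exists m.
Qed.

Lemma Inc_actI rho n x (s : finperm) : fixed_above act n x ->
  (forall i, (i < n)%N -> s i = rho i) -> Inc_act act rho x (act s x).
Proof.
move=> fx srho; have [m xm mn] := has_width_exists fx.
by exists m, s; split=> // i im; apply: srho; apply: leq_trans mn.
Qed.

End Actions.

(** * Variables carrying finitely many indices *)

Section Nominal.
Context (V : choiceType) (act : finperm -> V -> V) (ents : V -> seq nat).

(** The action of s on a variable depends only on the values of s at finitely
    many indices, which are moved along with the variable; the list of indices is
    only used as a set. *)
Definition nominal : Prop :=
  [/\ is_action act, forall s v, ents (act s v) =i map s (ents v) &
    forall (s t : finperm) v, {in ents v, s =1 t} -> act s v = act t v].

Hypothesis actN : nominal.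

Lemma fixed_above_index_bound n l :
  (forall v b, v \in l -> b \in ents v -> (b < n)%N) ->
  fixed_above (mon_act act) n (mprod l).
Proof.
have [[act1 _] _ loc] := actN.
move=> ln s sn; rewrite mon_act_mprod; congr mprod.
rewrite -[RHS]map_id; apply/eq_in_map => v vl; rewrite -[RHS]act1.
by apply: loc => b bv; rewrite sn ?finperm1E // (ln v).
Qed.

(** Exchanging an index that is at least n with a fresh one changes the monomial. *)
Lemma fixed_above_indices n l : fixed_above (mon_act act) n (mprod l) ->
  forall v b, v \in l -> b \in ents v -> (b < n)%N.
Proof.
have [_ ea _] := actN.
move=> fl v b vl bv; rewrite ltnNge; apply/negP => nb.
pose c := (index_bound ents l + n)%N.
have /fl : forall i, (i < n)%N -> transp b c i = i.
  by move=> i lt_in; rewrite transpE; case: eqP => [|_]; [lia | case: eqP => //; lia].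
rewrite mon_act_mprod => /mprod_eq/perm_mem/(_ (act (transp b c) v)).
rewrite map_f // => /esym h.
have := index_boundP (ents := ents) (b := c) h; rewrite ea.
have -> : c \in map (transp b c) (ents v).
  by apply/mapP; exists b => //; rewrite transpE eqxx.
by move=> /(_ isT); rewrite /c; lia.
Qed.

Lemma act_agrees s t rho l : agrees ents s rho l -> agrees ents t rho l ->
  map (act s) l = map (act t) l.
Proof.
have [_ _ loc] := actN.
by move=> hs ht; apply/eq_in_map => v vl; apply: loc => b bv; rewrite (hs v) ?(ht v).
Qed.

Lemma Inc_act_mprod rho l a' s : Inc_act (mon_act act) rho (mprod l) a' ->
  agrees ents s rho l -> a' = mprod (map (act s) l).
Proof.
move=> [n [t [[fl _] tn ->]]] sl; rewrite mon_act_mprod; congr mprod.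
apply: act_agrees sl => v b vl bv; apply: tn.
exact: (fixed_above_indices fl vl).
Qed.

Lemma agrees_exists rho l : in_Inc rho -> exists s, agrees ents s rho l.
Proof.
move=> rhoI; have [s sP] := finperm_of_Inc (index_bound ents l) rhoI.
by exists s => v b vl bv; apply: sP; apply: index_boundP bv.
Qed.

End Nominal.

(** * The graded reverse lexicographic order *)

Fixpoint lexle (s t : seq nat) : bool :=
  match s, t with
  | [::], _ => true
  | _ :: _, [::] => false
  | x :: s', y :: t' => (x < y)%N || (x == y) && lexle s' t'
  end.

Lemma lexle_refl s : lexle s s.
Proof. by elim: s => //= x s ->; rewrite eqxx orbT. Qed.

Lemma lexle_anti s t : lexle s t -> lexle t s -> s = t.
Proof.
elim: s t => [|x s IH] [|y t] //=; case: (ltngtP x y) => //= -> h1 h2.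
by rewrite (IH t).
Qed.

Lemma lexle_trans t s u : lexle s t -> lexle t u -> lexle s u.
Proof.
elim: t s u => [|y t IH] [|x s] [|z u] //=.
case: (ltngtP x y) => //= [xy _|-> xs].
  by case: (ltngtP y z) => //= [yz|<-] _; rewrite ?xy // (ltn_trans xy yz).
by case: (ltngtP y z) => //= _; apply: IH.
Qed.

Lemma lexle_total s t : lexle s t || lexle t s.
Proof. by elim: s t => [|x s IH] [|y t] //=; case: ltngtP => //= _; apply: IH. Qed.

Lemma lexle_map rho s t : in_Inc rho -> lexle (map rho s) (map rho t) = lexle s t.
Proof.
move=> rhoI; elim: s t => [|x s IH] [|y t] //=; rewrite IH.
case: (ltngtP x y) => [/rhoI -> //|/rhoI h|->]; last by rewrite ltnn eqxx.
by rewrite ltnNge (ltnW h) gtn_eqF.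
Qed.

(** The lexicographic order is well-founded only on lists of bounded size. *)
Lemma lexle_min n (S : seq nat -> Prop) : (forall s, S s -> (size s <= n)%N) ->
  (exists s, S s) -> exists2 s, S s & forall t, S t -> lexle s t.
Proof.
elim: n S => [|n IH] S Sn [s Ss].
  by exists s => // t _; have := Sn _ Ss; case: s {Ss}.
case: (classic (S [::])) => S0; first by exists [::].
have [|h hS hmin] := @nat_min (fun h => exists r, S (h :: r)).
  by case: s Ss => // x u Sx; exists x, u.
have [r Sr rmin] := IH (fun r => S (h :: r)) (fun r Sr => Sn _ Sr) hS.
exists (h :: r) => // -[|y t] St //=; have := hmin _ (ex_intro _ t St).
by rewrite leq_eqVlt => /predU1P[e|-> //]; subst y; rewrite eqxx rmin ?orbT.
Qed.

Section Grevlex.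
Context (V : choiceType) (key : V -> seq nat) (n : nat).
Hypotheses (key_inj : injective key) (key_size : forall v, (size (key v) <= n)%N).

Definition var_le (v w : V) : bool := lexle (key v) (key w).

Lemma var_le_anti v w : var_le v w -> var_le w v -> v = w.
Proof. by move=> h1 h2; apply: key_inj; apply: lexle_anti. Qed.

Lemma var_min (S : V -> Prop) : (exists v, S v) ->
  exists2 v, S v & forall w, S w -> var_le v w.
Proof.
move=> [v Sv]; have [||s [w [Sw ->]] wmin] := @lexle_min n (fun s => exists v, S v /\ s = key v).
- by move=> s [w [_ ->]].
- by exists (key v), v.
by exists w => // u Su; apply: wmin; exists u.
Qed.

(** For monomials of the same degree, this is the lexicographic order of the
    increasing lists of their variables. *)
Definition revlex_lt (a b : {cmonom V}) : Prop :=
  exists v, (b v < a v)%N /\ forall w, a w <> b w -> var_le v w.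

Definition grevlex_lt (a b : {cmonom V}) : Prop :=
  (mdeg a < mdeg b)%N \/ (mdeg a = mdeg b /\ revlex_lt a b).

Definition grevlex (a b : {cmonom V}) : Prop := a = b \/ grevlex_lt a b.

Lemma revlex_lt_trans b a c : revlex_lt a b -> revlex_lt b c -> revlex_lt a c.
Proof.
move=> [v [abv vmin]] [w [bcw wmin]].
have [u [uv uw hu]] : exists u, [/\ var_le u v, var_le u w & (u = v \/ u = w)].
  case/orP: (lexle_total (key v) (key w)) => h.
    by exists v; split=> //; [apply: lexle_refl | left].
  by exists w; split=> //; [apply: lexle_refl | right].
exists u; split; last first.
  move=> x acx; case: (eqVneq (a x) (b x)) => [ab|/eqP /vmin]; last exact: lexle_trans.
  by have /wmin : b x <> c x by [rewrite -ab]; apply: lexle_trans.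
case: hu => hu; subst u.
- apply: leq_ltn_trans abv; case: (eqVneq (b v) (c v)) => [-> //|/eqP /wmin wv].
  by rewrite (var_le_anti uw wv) ltnW.
apply: leq_trans bcw _; case: (eqVneq (a w) (b w)) => [-> //|/eqP /vmin vw].
by rewrite (var_le_anti uv vw) ltnW.
Qed.

Lemma revlex_lt_irr a : ~ revlex_lt a a.
Proof. by case=> v []; rewrite ltnn. Qed.

Lemma revlex_lt_total a b : a <> b -> revlex_lt a b \/ revlex_lt b a.
Proof.
move=> ab; have [|v abv vmin] := @var_min (fun v => a v <> b v).
  by apply: NNPP => h; apply: ab; apply: cmonom_eqP => v; apply: NNPP => h'; apply: h; exists v.
case: (ltngtP (a v) (b v)) => // h; [right|left]; exists v; split=> // w.
by move=> /nesym; apply: vmin.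
Qed.

Lemma revlex_lt_mul a b c : revlex_lt a b -> revlex_lt (mmul a c) (mmul b c).
Proof.
move=> [v [abv vmin]]; exists v; rewrite !cmM ltn_add2r; split=> // w.
by rewrite !cmM => h; apply: vmin => e; apply: h; rewrite e.
Qed.

Lemma grevlex_lt_irr a : ~ grevlex_lt a a.
Proof. by case=> [|[_ /revlex_lt_irr //]]; rewrite ltnn. Qed.

Lemma grevlex_lt_trans b a c : grevlex_lt a b -> grevlex_lt b c -> grevlex_lt a c.
Proof.
move=> [ab|[ab rab]] [bc|[bc rbc]].
- by left; apply: ltn_trans bc.
- by left; rewrite -bc.
- by left; rewrite ab.
by right; rewrite ab; split=> //; apply: revlex_lt_trans rab rbc.
Qed.

Lemma grevlex_lt_mul a b c : grevlex_lt a b -> grevlex_lt (mmul a c) (mmul b c).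
Proof.
rewrite /grevlex_lt !mdegM ltn_add2r => -[|[-> h]]; first by left.
by right; split=> //; apply: revlex_lt_mul.
Qed.

Lemma strict_grevlex a b : strict grevlex a b <-> grevlex_lt a b.
Proof.
split=> [[[]] //|ab]; split; first by right.
by move=> e; rewrite e in ab; apply: grevlex_lt_irr ab.
Qed.

(** Let v be the least variable that occurs in S.  A monomial divisible by v is
    smaller than a monomial of the same degree that is not, and the monomials of S
    divisible by v are compared after division by v. *)
Lemma revlex_min d (S : {cmonom V} -> Prop) : (forall a, S a -> mdeg a = d) ->
  (exists a, S a) -> exists2 a, S a & forall b, S b -> a = b \/ revlex_lt a b.
Proof.
elim: d S => [|d IH] S Sd [a Sa].
  exists a => // b Sb; left.
  by rewrite (mdeg_eq0I (Sd _ Sa)) (mdeg_eq0I (Sd _ Sb)).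
have [|v [l Sl] vmin] := @var_min (fun v => exists l, S (mprod (v :: l))).
  have [l al] := mprod_surj a; have := Sd _ Sa; rewrite al mdeg_mprod.
  by case: l al => // v l al _; exists v, l; rewrite -al.
have [||b Sb bmin] := IH (fun b => S (mmul (monvar v) b)).
- by move=> b /Sd; rewrite mdegM mdegU => -[].
- by exists (mprod l); rewrite -mprod_cons.
exists (mmul (monvar v) b) => // c Sc; have [m cm] := mprod_surj c.
case: (boolP (v \in m)) => vm.
  have cE : c = mmul (monvar v) (mprod (rem v m)).
    by rewrite cm -mprod_cons; apply/mprod_eq/perm_to_rem.
  rewrite cE in Sc *; have [->|h] := bmin _ Sc; first by left.
  by right; rewrite ![mmul (monvar v) _]mulmC; apply: revlex_lt_mul.
have cv : c v = 0%N by rewrite cm mprodE; apply/count_memPn.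
right; exists v; rewrite cv cmM cmUU; split=> // w.
have [q bq] := mprod_surj b.
have minP r x : S (mprod r) -> x \in r -> var_le v x.
  move=> Sr xr; apply: vmin; exists (rem x r).
  by have /mprod_eq <- := perm_to_rem xr.
rewrite bq -mprod_cons cm !mprodE => h.
case: (boolP (w \in v :: q)) => [|wq]; first by apply: minP; rewrite mprod_cons -bq.
case: (boolP (w \in m)) => [|wm]; first by apply: minP; rewrite -cm.
by case: h; rewrite (count_memPn wq) (count_memPn wm).
Qed.

Lemma grevlex_order (P : {cmonom V} -> Prop) : monomial_order P grevlex.
Proof.
split.
- move=> a b _ _ [//|ab] [//|ba].
  by case: (grevlex_lt_irr (grevlex_lt_trans ab ba)).
- move=> a b c _ _ _ [-> //|ab] [<-|bc]; first by right.
  by right; apply: grevlex_lt_trans bc.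
- move=> a b _ _; case: (eqVneq a b) => [->|/eqP nab]; first by left; left.
  case: (ltngtP (mdeg a) (mdeg b)) => [h|h|h]; [by left; right; left|by right; right; left|].
  by have [|] := revlex_lt_total nab; [left|right]; right; right.
- move=> S SP [a Sa].
  have [|d [b [Sb bd]] dmin] := @nat_min (fun d => exists a, S a /\ mdeg a = d).
    by exists (mdeg a), a.
  have [||c [Sc cd] cmin] := @revlex_min d (fun a => S a /\ mdeg a = d).
  + by move=> x [].
  + by exists b.
  exists c => // x Sx; have := dmin (mdeg x); rewrite leq_eqVlt => /(_ (ex_intro _ x (conj Sx erefl))).
  case/predU1P => [dx|dx]; last by right; left; rewrite cd.
  by have [|?] := cmin x (conj Sx (esym dx)); [left|right; right; rewrite cd].
move=> a b c _ _ _ [->|ab]; first by left.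
by right; apply: grevlex_lt_mul.
Qed.

Lemma grevlex_monvar v w : grevlex (monvar v) (monvar w) <-> var_le v w.
Proof.
split.
  case=> [/(congr1 (fun m : {cmonom V} => m w))|].
    by rewrite cmUU cmU; case: eqP => // -> _; apply: lexle_refl.
  case=> [|[_ [x []]]]; first by rewrite !mdegU.
  rewrite !cmU; case: (v =P x) => [<-|_]; last by rewrite ltn0.
  case: (w =P v) => // wv _; apply; rewrite !cmU eqxx.
  by case: (v =P w) wv => // ->.
move=> vw; case: (eqVneq v w) => [->|nvw]; first by left.
right; right; rewrite !mdegU; split=> //; exists v.
rewrite !cmU eqxx eq_sym (negbTE nvw); split=> // x.
by rewrite !cmU; case: eqP => [<- _|_]; [apply: lexle_refl | case: eqP => // <-].
Qed.

Lemma grevlex_reverse_lexicographic : reverse_lexicographic grevlex.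
Proof.
move=> a b dab nab; rewrite strict_grevlex; split.
  case=> [|[_ [v [h1 h2]]]]; first by rewrite dab ltnn.
  by exists v; split=> // w /h2 /grevlex_monvar.
move=> [v [h1 h2]]; right; split=> //; exists v; split=> // w.
by move=> /h2 /grevlex_monvar.
Qed.

Lemma grevlex_lt_map (g : V -> V) s t : injective g ->
  (forall v w, v \in s ++ t -> w \in s ++ t -> var_le v w -> var_le (g v) (g w)) ->
  grevlex_lt (mprod s) (mprod t) -> grevlex_lt (mprod (map g s)) (mprod (map g t)).
Proof.
move=> g_inj gle; rewrite /grevlex_lt !mdeg_mprod !size_map.
case=> [|[st [v [h1 h2]]]]; first by left.
right; split=> //; exists (g v).
have gE r x : mprod (map g r) (g x) = mprod r x.
  by rewrite !mprodE count_map; apply: eq_count => y /=; rewrite (inj_eq g_inj).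
rewrite !gE; split=> // w hw.
have : w \in map g (s ++ t).
  rewrite map_cat mem_cat -!has_pred1 !has_count -!mprodE.
  by move: hw; case: (mprod _ w) => [|?]; case: (mprod _ w) => [|?].
case/mapP => x xst wx; rewrite wx !gE in hw *.
apply: gle => //; last exact: h2.
rewrite mem_cat -has_pred1 has_count -mprodE.
by move: h1; case: (mprod s v).
Qed.

Section Inc.
Context (act : finperm -> V -> V) (ents : V -> seq nat).
Hypothesis actN : nominal act ents.
Hypothesis act_le : forall rho (s : finperm) v w, in_Inc rho ->
  {in ents v, s =1 rho} -> {in ents w, s =1 rho} ->
  var_le v w -> var_le (act s v) (act s w).

Lemma grevlex_lt_act rho s a b : in_Inc rho -> agrees ents s rho (a ++ b) ->
  grevlex_lt (mprod a) (mprod b) ->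
  grevlex_lt (mprod (map (act s) a)) (mprod (map (act s) b)).
Proof.
move=> rhoI sab; apply: grevlex_lt_map.
  by have [? _ _] := actN; apply: act_inj.
by move=> v w vl wl; apply: (act_le rhoI) => c; apply: sab.
Qed.

Lemma grevlex_Inc_respecting (P : {cmonom V} -> Prop) :
  Inc_respecting P grevlex (mon_act act).
Proof.
move=> rho rhoI a b a' b' _ _; have [l ->] := mprod_surj a; have [m ->] := mprod_surj b.
have [s slm] := agrees_exists ents (l ++ m) rhoI.
have sl : agrees ents s rho l by move=> v c vl; apply: slm; rewrite mem_cat vl.
have sm : agrees ents s rho m by move=> v c vl; apply: slm; rewrite mem_cat vl orbT.
move=> /(Inc_act_mprod actN)/(_ sl) -> /(Inc_act_mprod actN)/(_ sm) ->.
case=> [/mprod_eq lm|h]; last by right; exact: grevlex_lt_act rhoI slm h.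
by left; apply/mprod_eq; apply: perm_map.
Qed.

End Inc.
End Grevlex.

(** * The order on the monomials in Y' *)

Section Instances.
Context (N : nat) (k : 'I_N -> nat).
Local Notation Y' := (varY' k).
Local Notation Z := (varZ k).

Lemma nominal_Y' : nominal (@actY' N k) entries.
Proof.
split=> [|s v //|s t v st]; last first.
  by apply: varY'_eq => //; rewrite !entries_act; apply/eq_in_map.
split=> [y|s t y]; apply: varY'_eq => //; rewrite !entries_act.
  by rewrite -[RHS]map_id; apply: eq_map => i; rewrite finperm1E.
by rewrite -map_comp; apply: eq_map => i; rewrite finpermME.
Qed.

Definition indices_Z (z : Z) : seq nat := [:: (tagged z).2].

Lemma nominal_Z : nominal (@actZ N k) indices_Z.
Proof.
split=> [|s v //|s t [p [i j]] st]; last first.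
  by rewrite /actZ /= st // mem_head.
split=> [[p [i j]]|s t [p [i j]]]; rewrite /actZ /= ?finperm1E //.
by rewrite -finpermME.
Qed.

Definition indices_X l (x : varX l) : seq nat := [:: x.2].

Lemma nominal_X l : nominal (@actX l) (@indices_X l).
Proof.
split=> [|s v //|s t [i j] st]; last by rewrite /actX /= st // mem_head.
split=> [[i j]|s t [i j]]; rewrite /actX /= ?finperm1E //.
by rewrite -finpermME.
Qed.

(** The variables of Y' are ordered by type, then lexicographically by their
    entries. *)
Definition keyY' (y : Y') : seq nat := val (tag y) :: entries y.

Lemma keyY'_inj : injective keyY'.
Proof. by move=> y z [/val_inj]; apply: varY'_eq. Qed.

Lemma size_keyY' y : size (keyY' y) <= (maxarity k).+1.
Proof. by rewrite /= size_entries ltnS arity_le. Qed.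

Lemma keyY'_act rho (s : finperm) v w : in_Inc rho ->
  {in entries v, s =1 rho} -> {in entries w, s =1 rho} ->
  var_le keyY' v w -> var_le keyY' (actY' s v) (actY' s w).
Proof.
move=> rhoI /eq_in_map sv /eq_in_map sw; rewrite /var_le /keyY' !entries_act /=.
by rewrite sv sw lexle_map.
Qed.

Definition keyZ (z : Z) : seq nat :=
  [:: val (tag z); val (tagged z).1; (tagged z).2].

Lemma keyZ_inj : injective keyZ.
Proof.
move=> [p [i j]] [q [i' j']] [/val_inj /= pq]; case: q / pq i' => i' ii' ->.
by have /= -> := val_inj ii'.
Qed.

Lemma size_keyZ z : size (keyZ z) <= 3. Proof. by []. Qed.

Lemma keyZ_act rho (s : finperm) v w : in_Inc rho ->
  {in indices_Z v, s =1 rho} -> {in indices_Z w, s =1 rho} ->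
  var_le keyZ v w -> var_le keyZ (actZ s v) (actZ s w).
Proof.
move=> rhoI sv sw; rewrite /var_le /keyZ /= sv ?mem_head // sw ?mem_head //.
have := lexle_map [:: (tagged v).2] [:: (tagged w).2] rhoI.
by rewrite /= => ->.
Qed.

Definition zlist (y : Y') : seq Z :=
  [seq zvar i (tnth (val (tagged y)) i) | i <- enum 'I_(k (tag y))].

Lemma pi_mon_mprod l : pi_mon (mprod l) = mprod (flatten (map zlist l)).
Proof.
rewrite /pi_mon mon_ext_mprod; elim: l => [|y l IH].
  by rewrite big_nil mprod0.
by rewrite big_cons IH /= mprod_cat /mprod /zlist big_map big_enum.
Qed.

Lemma zlist_act s y : zlist (actY' s y) = map (actZ s) (zlist y).
Proof.
by rewrite /zlist -map_comp; apply: eq_map => i; rewrite /= /actZ /= tnth_map.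
Qed.

Lemma flatten_zlist_act s l :
  flatten (map zlist (map (actY' s) l)) = map (actZ s) (flatten (map zlist l)).
Proof. by rewrite map_flatten -!map_comp; congr flatten; apply: eq_map => y; apply: zlist_act. Qed.

Lemma pi_mon_act s l :
  pi_mon (mprod (map (actY' s) l)) = mon_act (@actZ N k) s (pi_mon (mprod l)).
Proof. by rewrite !pi_mon_mprod mon_act_mprod flatten_zlist_act. Qed.

Lemma count_zlist p (i : 'I_(k p)) b y :
  count_mem (zvar i b) (zlist y) = has_entry p i b y.
Proof.
rewrite /zlist count_map /has_entry.
case: (altP (tag y =P p)) => [yp|yp]; last first.
  rewrite (@eq_count _ _ pred0) ?count_pred0 // => j /=.
  by apply: contraNF yp => /eqP /(congr1 tag) /= ->.
case: p / yp i => i /=; rewrite (@eq_count _ _ (fun j => (j == i) && (nth 0 (entries y) i == b))).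
  case: eqP => _ /=; last by rewrite (@eq_count _ _ pred0) ?count_pred0 // => j /=; rewrite andbF.
  rewrite (@eq_count _ _ (pred1 i)) => [|j /=]; last by rewrite andbT.
  by rewrite count_uniq_mem ?enum_uniq // mem_enum.
move=> j /=; rewrite /zvar eq_Tagged /= xpair_eqE (tnth_nth 0).
by case: eqP => // ->.
Qed.

Lemma pi_monE (l : seq Y') p (i : 'I_(k p)) b : pi_mon (mprod l) (zvar i b) = cell p i b l.
Proof.
rewrite pi_mon_mprod mprodE count_flatten -map_comp sumnE big_map /cell.
rewrite (eq_bigr (fun y => has_entry p i b y : nat)) => [|y _].
  by rewrite -sum1_count [RHS]big_mkcond; apply: eq_bigr => y _; case: has_entry.
exact: count_zlist.
Qed.

Lemma pi_mon_eqP (l m : seq Y') : pi_mon (mprod l) = pi_mon (mprod m) <->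
  forall p (i : 'I_(k p)) b, cell p i b l = cell p i b m.
Proof.
split=> [h p i b|h]; first by rewrite -!pi_monE h.
by apply: cmonom_eqP => -[p [i b]]; rewrite -/(zvar i b) !pi_monE.
Qed.

Lemma column_equiv_pi (l m : seq Y') : column_equiv l m -> pi_mon (mprod l) = pi_mon (mprod m).
Proof. by case=> _ h; apply/pi_mon_eqP. Qed.

Lemma pi_monM a b : @pi_mon N k (mmul a b) = mmul (pi_mon a) (pi_mon b).
Proof. exact: mon_extM. Qed.

Local Notation le1 := (grevlex keyZ).
Local Notation le2 := (grevlex keyY').

(** The strict part of the order on [Y'] obtained by taking for both <=_1 and <=_2
    the graded reverse lexicographic order. *)
Definition ltY' (a b : {cmonom Y'}) : Prop :=
  grevlex_lt keyZ (pi_mon a) (pi_mon b) \/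
  (pi_mon a = pi_mon b /\ grevlex_lt keyY' a b).

Lemma le'E a b : le' le1 le2 a b <-> (a = b \/ ltY' a b).
Proof.
by split=> -[->|h]; [left| right | left | right] => //; move: h;
  rewrite /lt' /ltY' !strict_grevlex.
Qed.

Lemma ltY'_irr a : ~ ltY' a a.
Proof. by case=> [|[_]] /grevlex_lt_irr. Qed.

Lemma ltY'_trans b a c : ltY' a b -> ltY' b c -> ltY' a c.
Proof.
move=> [ab|[ab ab']] [bc|[bc bc']].
- by left; apply: grevlex_lt_trans keyZ_inj _ _ _ ab bc.
- by left; rewrite -bc.
- by left; rewrite ab.
by right; split; [rewrite ab | apply: grevlex_lt_trans keyY'_inj _ _ _ ab' bc'].
Qed.

Lemma ltY'_mul a b c : ltY' a b -> ltY' (mmul a c) (mmul b c).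
Proof.
move=> [h|[h1 h2]]; rewrite /ltY' !pi_monM.
  by left; apply: grevlex_lt_mul.
by right; rewrite h1; split=> //; apply: grevlex_lt_mul.
Qed.

Lemma le'_order : monomial_order (@all_monomials _) (le' le1 le2).
Proof.
have [_ _ tot1 min1 _] := grevlex_order keyZ_inj size_keyZ (@all_monomials _).
have [_ _ tot2 min2 _] := grevlex_order keyY'_inj size_keyY' (@all_monomials _).
split.
- move=> a b _ _ /le'E [//|ab] /le'E [//|ba].
  by case: (ltY'_irr (ltY'_trans ab ba)).
- move=> a b c _ _ _ /le'E [-> //|ab] /le'E [<-|bc]; apply/le'E; right=> //.
  exact: ltY'_trans bc.
- move=> a b _ _; case: (classic (pi_mon a = pi_mon b)) => pab.
    have [] := tot2 a b I I => -[->|h]; [left|left|right|right]; apply/le'E;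
      by [left | right; right].
  have [] := tot1 (pi_mon a) (pi_mon b) I I => -[h|h]; [by []|left| |right].
  + by apply/le'E; right; left.
  + by rewrite h in pab.
  by apply/le'E; right; left.
- move=> S _ [a Sa].
  have [||z [b [Sb bz]] zmin] := min1 (fun z => exists b, S b /\ pi_mon b = z).
  + by [].
  + by exists (pi_mon a), a.
  have [||c [Sc cz] cmin] := min2 (fun b => S b /\ pi_mon b = z); first by [].
    by exists b.
  exists c => // d Sd; apply/le'E.
  have [h|h] := zmin _ (ex_intro _ d (conj Sd erefl)); last by right; left; rewrite cz.
  have [->|h'] := cmin d (conj Sd (esym h)); first by left.
  by right; right; rewrite cz.
move=> a b c _ _ _ /le'E [->|h]; apply/le'E; first by left.
by right; apply: ltY'_mul.
Qed.

Lemma agrees_zlist s rho l : agrees entries s rho l ->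
  agrees indices_Z s rho (flatten (map zlist l)).
Proof.
move=> sl z b /flatten_mapP [y yl /mapP [i _ ->]]; rewrite inE => /eqP ->.
by apply: sl yl _; rewrite (tnth_nth 0) mem_nth // size_entries.
Qed.

Lemma lt_pi_act rho s l m : in_Inc rho -> agrees entries s rho (l ++ m) ->
  grevlex_lt keyZ (pi_mon (mprod l)) (pi_mon (mprod m)) ->
  grevlex_lt keyZ (pi_mon (mprod (map (@actY' N k s) l)))
                  (pi_mon (mprod (map (@actY' N k s) m))).
Proof.
move=> rhoI slm; rewrite !pi_mon_mprod !flatten_zlist_act.
apply: (grevlex_lt_act nominal_Z keyZ_act rhoI).
by have := agrees_zlist slm; rewrite map_cat flatten_cat.
Qed.

Lemma ltY'_act rho s l m : in_Inc rho -> agrees entries s rho (l ++ m) ->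
  ltY' (mprod l) (mprod m) ->
  ltY' (mprod (map (@actY' N k s) l)) (mprod (map (@actY' N k s) m)).
Proof.
move=> rhoI slm [h|[h1 h2]]; first by left; exact: lt_pi_act rhoI slm h.
right; rewrite !pi_mon_act h1; split=> //.
exact: (grevlex_lt_act nominal_Y' keyY'_act rhoI).
Qed.

End Instances.

(** * Nonminimal monomials in Y' *)

(** The map F stands for the composite of theta with the restriction of phi to
    monomials.  A monomial is nonminimal if a smaller one has the same image. *)
Section NonMinimal.
Context (N : nat) (k : 'I_N -> nat).
Local Notation Y' := (varY' k).
Local Notation actl s := (map (@actY' N k s)).
Context (T : Type) (F : {cmonom Y'} -> T).
Hypotheses (F_mul : forall a b c, F a = F b -> F (mmul a c) = F (mmul b c))
  (F_pi : forall a b, pi_mon a = pi_mon b -> F a = F b)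
  (F_act : forall s l m, F (mprod l) = F (mprod m) ->
     F (mprod (actl s l)) = F (mprod (actl s m))).

Definition nonminimal (u : {cmonom Y'}) : Prop := exists v, ltY' v u /\ F v = F u.

(** The two ways of being nonminimal correspond to the two steps in the definition
    of the order: the smaller monomial differs already under pi, or it has the
    same image under pi. *)
Definition nonminimal1 (u : {cmonom Y'}) : Prop :=
  exists v, grevlex_lt (@keyZ N k) (pi_mon v) (pi_mon u) /\ F v = F u.

Definition nonminimal2 (u : {cmonom Y'}) : Prop :=
  exists v, grevlex_lt (@keyY' N k) v u /\ pi_mon v = pi_mon u.

Lemma nonminimalE u : nonminimal u <-> nonminimal1 u \/ nonminimal2 u.
Proof.
split=> [[v [[h|[h1 h2]] Fv]]|[[v [h Fv]]|[v [h pv]]]].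
- by left; exists v.
- by right; exists v.
- by exists v; split=> //; left.
by exists v; split; [right | apply: F_pi].
Qed.

(** This property depends only on pi(u), and finitely many monomials v generate
    all the others up to Inc(N) in the image of pi.  If pi(u) is divisible there
    by the image of v, then so is pi(u0) for a divisor u0 of bounded degree. *)
Lemma bounded_divisor1 : exists C, forall u, nonminimal1 (mprod u) ->
  exists u0 u1, [/\ perm_eq u (u0 ++ u1), size u0 <= C & nonminimal1 (mprod u0)].
Proof.
have [L [LS LP]] := good_finite_basis (fun l => nonminimal1 (mprod l))
  (@Inc_divides_refl N k) (@good_Inc_divides N k).
exists (covering_size k * \max_(v <- L) size v) => u /LP [v vL [rho [rhoI vu]]].
have [x [xv Fx]] := LS v vL; have [m xm] := mprod_surj x; subst x.
have [s smv] := agrees_exists entries (m ++ v) rhoI.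
have [_ sv] := agrees_cat smv.
have [w uw] := vu s sv.
have [u0 [u1 [w0 [pu su u0w]]]] := divisor_of_rows uw.
exists u0, u1; split=> //.
  apply: leq_trans su _; rewrite size_map leq_mul2l; apply/orP; right.
  exact: (@leq_bigmax_seq _ L predT size v vL isT).
have pu0 := column_equiv_pi u0w.
exists (mprod (actl s m ++ w0)); split.
  rewrite pu0 !mprod_cat !pi_monM; apply: grevlex_lt_mul.
  exact: lt_pi_act rhoI smv xv.
by rewrite (F_pi pu0) !mprod_cat; apply: F_mul; apply: F_act.
Qed.

Lemma sum_height (l : seq Y') : \sum_p height p l = size l.
Proof.
elim: l => [|y l IH]; first by rewrite big1.
rewrite /height /= big_split /= -/(height _ _) IH (bigD1 (tag y)) //= eqxx big1 //.
by move=> p; rewrite eq_sym => /negbTE ->.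
Qed.

Lemma column_equiv_size (l m : seq Y') : column_equiv l m -> size l = size m.
Proof. by case=> h _; rewrite -!sum_height; apply: eq_bigr. Qed.

(** The map pi determines the number of rows of positive length; the condition on
    the sizes leaves no room for rows of length 0 in the second list. *)
Lemma pi_mon_column_equiv (l m : seq Y') :
  pi_mon (mprod l) = pi_mon (mprod m) -> (forall y, y \in l -> 0 < k (tag y)) ->
  size m <= size l -> column_equiv l m.
Proof.
move=> /pi_mon_eqP lm l0 ml; split=> // p.
have heq q : 0 < k q -> height q l = height q m.
  move=> kq; pose i := Ordinal kq; pose n := index_bound entries (l ++ m).
  rewrite -(@sum_cell _ _ _ i l n) => [|y a yl]; last first.
    by apply: index_boundP; rewrite mem_cat yl.
  rewrite -(@sum_cell _ _ _ i m n) => [|y a ym]; last first.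
    by apply: index_boundP; rewrite mem_cat ym orbT.
  by apply: eq_bigr => b _; apply: lm.
have hle q : height q l <= height q m.
  case: (posnP (k q)) => [kq|/heq -> //].
  suff -> : height q l = 0 by [].
  apply/eqP; rewrite -leqn0 leqNgt -has_count; apply/hasPn => y yl.
  by apply: contraL (l0 y yl) => /eqP ->; rewrite kq.
apply/eqP; rewrite eqn_leq hle /=; move: ml; rewrite -!sum_height.
rewrite (bigD1 p) //= [X in _ <= X](bigD1 p) //=.
move=> ml; rewrite -(leq_add2r (\sum_(i < N | i != p) height i m)).
by apply: leq_trans ml _; rewrite leq_add2l; apply: leq_sum => q _.
Qed.

Lemma multiset_common_part (V : choiceType) (u v : seq V) : exists g u' v',
  [/\ perm_eq u (g ++ u'), perm_eq v (g ++ v') &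
    forall x, count_mem x u' = count_mem x u - count_mem x v].
Proof.
have [u' u'E] := mprod_surj (divcm (mprod u) (mprod v)).
have cu' x : count_mem x u' = count_mem x u - count_mem x v.
  by rewrite -!mprodE -u'E divcmE.
have [x|g ug] := @mprod_cofactor _ u' u; first by rewrite !mprodE cu' leq_subr.
have cg x : count_mem x u = count_mem x u' + count_mem x g.
  by rewrite (seq.permP ug) count_cat.
have [x|v' vg] := @mprod_cofactor _ g v.
  by rewrite !mprodE; have := cg x; rewrite cu'; lia.
by exists g, u', v'; split=> //; rewrite (permPl ug) perm_catC.
Qed.

(** A variable with k_p = 0 is nonminimal by itself, as it has the same image under
    pi as 1.  Otherwise v < u with pi(v) = pi(u) forces equal degrees, and after
    cancelling common factors, v contains a variable y smaller than all those of
    u.  Some divisor u0 of u of bounded degree has the same image under pi as a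
    monomial that contains y, and this monomial is smaller than u0 for the reverse
    lexicographic order. *)
Lemma bounded_divisor2 u : nonminimal2 (mprod u) ->
  exists u0 u1, [/\ perm_eq u (u0 ++ u1), size u0 <= (covering_size k).+1 &
    nonminimal2 (mprod u0)].
Proof.
case: (boolP (has (fun y => k (tag y) == 0) u)) => [/hasP [y yu /eqP ky] _|].
  exists [:: y], (rem y u); split=> //; first exact: perm_to_rem.
  exists (mprod [::]); split; first by left; rewrite !mdeg_mprod.
  apply/pi_mon_eqP => p i b; rewrite /cell /= /has_entry.
  by case: eqP => // yp; move: (ltn_ord i); rewrite -[X in _ < X](congr1 k yp) ky.
move=> /hasPn u_pos [x [ltxu pxu]]; have [v xv] := mprod_surj x; subst x.
have vu : column_equiv u v.
  apply: pi_mon_column_equiv => // [y /u_pos|]; first by rewrite lt0n.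
  by rewrite -!mdeg_mprod; case: ltxu => [/ltnW|[->]].
have [|[_ [y [yuv ymin]]]] := ltxu; first by rewrite !mdeg_mprod (column_equiv_size vu) ltnn.
have [g [u' [v' [ug vg cu']]]] := multiset_common_part u v.
have u'v' : column_equiv u' v'.
  apply: (@column_equiv_cancel _ _ g).
  apply: column_equiv_trans (column_equiv_sym (column_equiv_perm ug)) _.
  exact: column_equiv_trans vu (column_equiv_perm vg).
have yu' : y \notin u'.
  by apply/count_memPn; rewrite cu'; move: yuv; rewrite !mprodE; lia.
have yv' : y \in v'.
  rewrite -has_pred1 has_count; move: yuv; rewrite !mprodE.
  have := seq.permP ug (pred1 y); have := seq.permP vg (pred1 y).
  by rewrite !count_cat; lia.
have [u0 [u1 [w0 [pu su u0w]]]] := divisor_of_row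
  (column_equiv_trans u'v' (column_equiv_perm (perm_to_rem yv'))).
have u0u' x : x \in u0 -> x \in u' by rewrite (perm_mem pu) mem_cat => ->.
exists u0, (g ++ u1); split; last 1 first.
- exists (mprod (y :: w0)); split; last by rewrite (column_equiv_pi u0w).
  right; rewrite !mdeg_mprod (column_equiv_size u0w); split=> //.
  have yu0 : mprod u0 y = 0%N.
    by rewrite mprodE; apply/count_memPn; apply: contra yu'; apply: u0u'.
  have yyw : (0 < mprod (y :: w0) y)%N by rewrite mprodE /= eqxx.
  have [e|//|[x [hx xmin]]] := @revlex_lt_total _ (@keyY' N k) _
      (@size_keyY' N k) (mprod (y :: w0)) (mprod u0).
    by move: yyw; rewrite e yu0.
  have xu0 : x \in u0.
    by rewrite -has_pred1 has_count -mprodE; apply: leq_ltn_trans hx.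
  have xy : var_le (@keyY' N k) x y by apply: xmin; rewrite yu0; lia.
  have yx : var_le (@keyY' N k) y x.
    apply: ymin; rewrite !mprodE; have := u0u' _ xu0.
    by rewrite -has_pred1 has_count cu'; lia.
  have exy := var_le_anti (@keyY'_inj N k) xy yx.
  by rewrite -exy (u0u' _ xu0) in yu'.
- by rewrite (permPl ug) perm_sym perm_catCA perm_cat2l perm_sym.
exact: leqW.
Qed.

(** By the two preceding lemmas, the nonminimal monomials of bounded degree
    generate all of them; up to Inc(N), finitely many of these suffice. *)
Lemma nonminimal_finite_basis : exists L : seq (seq Y'),
  (forall f, f \in L -> nonminimal (mprod f)) /\
  forall u, nonminimal (mprod u) -> exists f u0 u1,
    [/\ f \in L, perm_eq u (u0 ++ u1) & Inc_image f u0].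
Proof.
have [C1 hC1] := bounded_divisor1.
pose C := maxn C1 (covering_size k).+1.
have [|L [LS LP]] := @bounded_size_basis N k C
  (fun u => nonminimal (mprod u) /\ size u <= C); first by move=> u [].
exists L; split=> [f /LS [] //|u nu].
have [u0 [u1 [pu su nu0]]] : exists u0 u1,
    [/\ perm_eq u (u0 ++ u1), size u0 <= C & nonminimal (mprod u0)].
  case/nonminimalE: nu => [/hC1|/bounded_divisor2] [u0 [u1 [pu su nu0]]].
    exists u0, u1; split=> //; first by rewrite leq_max su.
    by apply/nonminimalE; left.
  exists u0, u1; split=> //; first by rewrite leq_max su orbT.
  by apply/nonminimalE; right.
by have [f fL fu0] := LP u0 (conj nu0 su); exists f, u0, u1.
Qed.

End NonMinimal.

(** * Orbit representatives *)

Section Representatives.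
Context (Y : choiceType) (act : finperm -> Y -> Y).
Hypotheses (actP : is_action act) (wid : forall y, exists n, fixed_above act n y).

Definition same_orbit (x y : Y) : Prop := exists s, y = act s x.

Lemma same_orbit_sym x y : same_orbit x y -> same_orbit y x.
Proof.
move=> [s ->]; have [t [ts _]] := finperm_inverse s; exists t.
by rewrite -actP.2 ts actP.1.
Qed.

Lemma same_orbit_trans y x z : same_orbit x y -> same_orbit y z -> same_orbit x z.
Proof. by move=> [s ->] [t ->]; exists (finpermM t s); rewrite actP.2. Qed.

Definition minimal_width (r : Y) (n : nat) : Prop :=
  has_width act r n /\ forall s m, has_width act (act s r) m -> n <= m.

Lemma minimal_width_exists x : exists r n, same_orbit x r /\ minimal_width r n.
Proof.
have [|n [s xn] nmin] := @nat_min (fun m => exists s, has_width act (act s x) m).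
  have [n xn] := wid x; have [m xm _] := has_width_exists xn.
  by exists m, finperm1; rewrite actP.1.
exists (act s x), n; split; first by exists s.
split=> // t m; rewrite -actP.2 => tm; apply: nmin; by exists (finpermM t s).
Qed.

Lemma orbit_transversal (L : seq Y) : exists R : seq Y, [/\ uniq R,
  forall x, x \in L -> exists2 r, r \in R & same_orbit r x,
  forall r, r \in R -> exists n, minimal_width r n &
  forall r r', r \in R -> r' \in R -> same_orbit r r' -> r = r'].
Proof.
elim: L => [|x L [R [uR RL Rmin Rinj]]]; first by exists [::].
case: (classic (exists2 r, r \in R & same_orbit r x)) => [rx|h].
  by exists R; split=> // y; rewrite inE => /predU1P[-> //|/RL].
have [r [n [xr rn]]] := minimal_width_exists x.
have nr r' : r' \in R -> ~ same_orbit r' r.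
  move=> r'R r'r; apply: h; exists r' => //.
  exact: same_orbit_trans r'r (same_orbit_sym xr).
exists (r :: R); split.
- by rewrite /= uR andbT; apply/negP => /nr; apply; exists finperm1; rewrite actP.1.
- move=> y; rewrite inE => /predU1P[->|/RL [r' r'R ?]].
    by exists r; [rewrite mem_head | exact: same_orbit_sym].
  by exists r' => //; rewrite inE r'R orbT.
- by move=> r'; rewrite inE => /predU1P[->|/Rmin //]; exists n.
move=> r1 r2; rewrite !inE => /predU1P[->|r1R] /predU1P[->|r2R] // r12.
- by case: (nr _ r2R); apply: same_orbit_sym.
- by case: (nr _ r1R).
exact: Rinj.
Qed.

Lemma representatives_exist (L : seq Y) :
  (forall y, exists2 x, x \in L & same_orbit x y) ->
  exists N (k : 'I_N -> nat) rep, is_representatives k act rep.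
Proof.
move=> Lcov; have [R [uR RL Rmin Rinj]] := orbit_transversal L.
pose rep (p : 'I_(size R)) := tnth (in_tuple R) p.
have repR p : rep p \in R by apply: mem_tnth.
pose k p := sval (constructive_indefinite_description _ (Rmin _ (repR p))).
have kP p : minimal_width (rep p) (k p).
  by rewrite /k; case: constructive_indefinite_description.
exists (size R), k, rep; split=> [y|p|p s n].
- have [x /RL [r /(tnthP (in_tuple R)) [p rp] rx] xy] := Lcov y.
  exists p; have py : same_orbit (rep p) y.
    by rewrite /rep -rp; apply: same_orbit_trans rx xy.
  split=> // q qy; apply: (tuple_uniqP (in_tuple R) uR).
  apply: Rinj; try exact: repR.
  exact: same_orbit_trans py (same_orbit_sym qy).
- by case: (kP p).
by case: (kP p) => _; apply.
Qed.

End Representatives.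

(** * The parametrisation of Y by Y' *)

Section Theta.
Context (Y : choiceType) (act : finperm -> Y -> Y) (actP : is_action act).
Context (N : nat) (k : 'I_N -> nat) (rep : 'I_N -> Y).
Hypothesis repP : is_representatives k act rep.
Local Notation Y' := (varY' k).
Local Notation act' := (@actY' N k).

Let act'N : nominal act' entries := @nominal_Y' N k.
Let act'P : is_action act'. Proof. by case: act'N. Qed.

(** A permutation that maps 0, ..., k_p - 1 to the entries of v carries the
    representative y_p to the image of v under theta. *)
Lemma placement_exists (v : Y') : exists s : finperm,
  forall i, i < k (tag v) -> s i = nth 0 (entries v) i.
Proof.
apply: finperm_extension => i j hi hj /eqP.
by rewrite nth_uniq ?size_entries ?uniq_entries // => /eqP.
Qed.

Definition placement (v : Y') : finperm :=
  sval (constructive_indefinite_description _ (placement_exists v)).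

Lemma placementP (v : Y') i : i < k (tag v) -> placement v i = nth 0 (entries v) i.
Proof. by move: i; rewrite /placement; case: constructive_indefinite_description. Qed.

Definition theta_var (v : Y') : Y := act (placement v) (rep (tag v)).

Lemma theta_var_placement (v : Y') (s : finperm) :
  (forall i, i < k (tag v) -> s i = nth 0 (entries v) i) ->
  theta_var v = act s (rep (tag v)).
Proof.
move=> sP; have [_ /(_ (tag v)) [fr _] _] := repP.
by apply: (act_eq_of_fixed actP fr) => i hi; rewrite placementP // sP.
Qed.

Lemma theta_var_act s v : theta_var (act' s v) = act s (theta_var v).
Proof.
rewrite [in RHS]/theta_var -actP.2; apply: theta_var_placement => i hi.
by rewrite finpermME placementP // entries_act (nth_map 0) // size_entries.
Qed.

Lemma theta_var_base p : theta_var (baseY' k p) = rep p.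
Proof.
rewrite -[RHS]actP.1; apply: theta_var_placement => i hi.
by rewrite finperm1E nth_iota.
Qed.

Lemma theta_var_surj y : exists v, theta_var v = y.
Proof.
have [/(_ y) [p [[s ->] _]] _ _] := repP.
by exists (act' s (baseY' k p)); rewrite theta_var_act theta_var_base.
Qed.

(** Let t exchange a with an index c fixed by s and fresh for v and w.  Then t
    fixes y, which is the image of w, and s fixes the entries of t v. *)
Lemma drop_index v w a : theta_var v = theta_var w -> a \notin entries w ->
  forall s : finperm, (forall b, b \in entries v -> b != a -> s b = b) ->
  act s (theta_var v) = theta_var v.
Proof.
have [_ _ loc] := act'N.
move=> vw aw s sv.
have [n sn] := finperm_support s.
pose c := n + (index_bound entries [:: v; w]).
have cv : c \notin entries v.
  by apply/negP => /(index_boundP (mem_head v [:: w])); rewrite /c ltnNge leq_addl.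
have cw : c \notin entries w.
  have wvw : w \in [:: v; w] by rewrite !inE eqxx orbT.
  by apply/negP => /(index_boundP wvw); rewrite /c ltnNge leq_addl.
pose t := transp a c.
have tw : act' t w = w.
  rewrite -[RHS](act'P.1 w); apply: loc => b bw; rewrite transpE finperm1E.
  by case: eqP => [ba|_]; [rewrite -ba bw in aw | case: eqP => // bc; move: cw; rewrite -bc bw].
have ty : act t (theta_var v) = theta_var v by rewrite vw -theta_var_act tw.
rewrite -[in LHS]ty -[RHS]ty -theta_var_act -theta_var_act.
congr theta_var; apply: varY'_eq => //; rewrite !entries_act -map_comp.
apply/eq_in_map => b bv /=; rewrite transpE.
case: (altP (b =P a)) => [_|ba]; first by rewrite sn // leq_addr.
by case: eqP => [bc|_]; [by move: cv; rewrite -bc bv | rewrite sv].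
Qed.

(** If v had an entry that is missing in w, then its image would be fixed by all
    permutations that fix the other k_p - 1 entries of v, and moving these to the
    first k_p - 1 indices would give an element of the orbit of y_p whose width
    is smaller than k_p. *)
Lemma theta_var_entries_sub v w : theta_var v = theta_var w ->
  {subset entries v <= entries w}.
Proof.
move=> vw a av; apply/negPn/negP => aw.
have fixv := drop_index vw aw.
set p := tag v; set i := index a (entries v).
have ik : i < k p by rewrite -size_entries index_mem.
have ai : nth 0 (entries v) i = a by apply: nth_index.
have [s0 [s0s ss0]] := finperm_inverse (placement v).
pose m := finpermM (transp i (k p).-1) s0.
have [m0 [m0m mm0]] := finperm_inverse m.
have fz : fixed_above act (k p).-1 (act m (theta_var v)).
  move=> s sk; rewrite -[LHS]actP.1 -mm0 actP.2; congr (act m).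
  rewrite -(actP.2 m0 s) -(actP.2 _ m).
  apply: fixv => b bv ba.
  rewrite (finpermME _ m) (finpermME m0 s).
  have jk : index b (entries v) < k p by rewrite -size_entries index_mem.
  have bj : s0 b = index b (entries v).
    by rewrite -[in LHS](nth_index 0 bv) -placementP // -finpermME s0s finperm1E.
  have mb : m b < (k p).-1.
    rewrite finpermME bj transpE.
    have ji : index b (entries v) != i.
      by apply: contraNneq ba => e; rewrite -(nth_index 0 bv) e ai.
    have arith x y z : x < z -> y < z -> x != y -> (if x == z.-1 then y else x) < z.-1.
      by move=> xz yz /eqP xy; case: eqP => xz1; lia.
    by rewrite (negbTE ji) arith.
  by rewrite sk // -(finpermME m0 m) m0m finperm1E.
have [n zn nk] := has_width_exists fz.
have [_ _ /(_ p (finpermM m (placement v)) n)] := repP.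
by rewrite actP.2 => /(_ zn); lia.
Qed.

Lemma theta_var_entries v w : theta_var v = theta_var w -> entries v =i entries w.
Proof.
by move=> vw b; apply/idP/idP; apply: theta_var_entries_sub; rewrite vw.
Qed.

Lemma theta_var_lift s y v : theta_var v = act s y ->
  exists2 w, v = act' s w & theta_var w = y.
Proof.
move=> vy; have [w wv] := act_surj act'P s v; exists w => //.
by apply: (act_inj actP (s := s)); rewrite -theta_var_act wv.
Qed.

(** By [theta_var_entries], the choice of the preimage is immaterial. *)
Definition indices_Y (y : Y) : seq nat :=
  entries (sval (constructive_indefinite_description _ (theta_var_surj y))).

Lemma indices_Y_theta v : indices_Y (theta_var v) =i entries v.
Proof.
rewrite /indices_Y; case: constructive_indefinite_description => w /= wv.
exact: theta_var_entries.
Qed.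

Lemma nominal_Y : nominal act indices_Y.
Proof.
split=> // [s y|s t y st]; have [v vy] := theta_var_surj y.
  rewrite -vy -theta_var_act => b; rewrite indices_Y_theta entries_act.
  by apply/mapP/mapP => -[c cv ->]; exists c => //; rewrite indices_Y_theta in cv *.
rewrite -vy -!theta_var_act; congr theta_var; have [_ _ loc] := act'N.
by apply: loc => b bv; apply: st; rewrite -vy indices_Y_theta.
Qed.

(** * The order on the monomials in Y *)

Local Notation le1 := (grevlex (@keyZ N k)).
Local Notation le2 := (grevlex (@keyY' N k)).
Local Notation leY' := (le' le1 le2).

Lemma nu_exists y : exists v, theta_var v = y /\
  forall w, theta_var w = y -> leY' (monvar v) (monvar w).
Proof.
have [_ _ _ min _] := le'_order k.
have [||_ [v -> vy] vmin] := min (fun m => exists2 v, m = monvar v & theta_var v = y).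
- by [].
- by have [v vy] := theta_var_surj y; exists (monvar v), v.
exists v; split=> [|w wy]; first exact: vy.
by apply: vmin; exists w.
Qed.

Definition nu (y : Y) : Y' :=
  sval (constructive_indefinite_description _ (nu_exists y)).

Lemma nuK : cancel nu theta_var.
Proof. by move=> y; rewrite /nu; case: constructive_indefinite_description => v []. Qed.

Lemma nu_min v : leY' (monvar (nu (theta_var v))) (monvar v).
Proof.
rewrite /nu; case: constructive_indefinite_description => w /= [_]; exact.
Qed.

Lemma nu_entries v : entries (nu (theta_var v)) =i entries v.
Proof. by apply: theta_var_entries; rewrite nuK. Qed.

(** All preimages of y have the same entries as nu(y), so rho acts on all of them
    and preserves their order; and every preimage of rho y is of the form rho w
    for a preimage w of y. *)
Lemma nu_act rho (s : finperm) y : in_Inc rho -> {in entries (nu y), s =1 rho} ->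
  nu (act s y) = act' s (nu y).
Proof.
move=> rhoI sr; have [w e wy] := theta_var_lift (nuK (act s y)).
rewrite e; congr act'; apply: NNPP => wnu.
have [h|h] := (le'E _ _).1 (nu_min w).
  by case: wnu; rewrite -(monvar_inj h) wy.
have {}h : ltY' (mprod [:: nu y]) (mprod [:: w]) by rewrite !mprod1 -wy.
have ag : agrees entries s rho ([:: nu y] ++ [:: w]).
  move=> v b; rewrite !inE => /orP[/eqP->|/eqP->] bv; apply: sr => //.
  by rewrite -wy nu_entries.
have := ltY'_act rhoI ag h; rewrite /= !mprod1 -e => h1.
have [e2|h2] := (le'E _ _).1 (nu_min (act' s (nu y))).
  rewrite theta_var_act nuK in e2; rewrite e2 in h1; exact: ltY'_irr h1.
rewrite theta_var_act nuK in h2.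
exact: ltY'_irr (ltY'_trans h1 h2).
Qed.

Definition leY (a b : {cmonom Y}) : Prop :=
  leY' (mon_ext (fun y => monvar (nu y)) a) (mon_ext (fun y => monvar (nu y)) b).

Lemma nu_mon_inj : injective (mon_ext (fun y => monvar (nu y))).
Proof.
move=> a b; have [l ->] := mprod_surj a; have [m ->] := mprod_surj b.
rewrite !mon_ext_var => /mprod_eq/(perm_map theta_var).
by rewrite !mapK => [/mprod_eq//||]; apply: nuK.
Qed.

Lemma leY_order : monomial_order (@all_monomials _) leY.
Proof.
have [anti trans tot min mul] := le'_order k; rewrite /leY; split.
- by move=> a b _ _ h1 h2; apply: nu_mon_inj; apply: anti.
- by move=> a b c _ _ _; apply: trans.
- by move=> a b _ _; apply: tot.
- move=> S _ [a Sa].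
  have [||z [b Sb ->] bmin] := min (fun z => exists2 a, S a & z = mon_ext (fun y => monvar (nu y)) a).
  + by [].
  + by exists (mon_ext (fun y => monvar (nu y)) a), a.
  by exists b => // c Sc; apply: bmin; exists c.
by move=> a b c _ _ _; rewrite !mon_extM; apply: mul.
Qed.

Lemma map_nu_act rho s l : in_Inc rho -> agrees indices_Y s rho l ->
  map nu (map (act s) l) = map (act' s) (map nu l).
Proof.
move=> rhoI sl; rewrite -!map_comp; apply/eq_in_map => y yl /=.
apply: (nu_act rhoI) => b bnu; apply: sl yl _.
by rewrite -(nuK y) indices_Y_theta.
Qed.

Lemma agrees_map_nu s rho l : agrees indices_Y s rho l ->
  agrees entries s rho (map nu l).
Proof.
move=> sl v b /mapP [y yl ->] bv; apply: sl yl _.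
by rewrite -(nuK y) indices_Y_theta.
Qed.

Definition ltY (a b : {cmonom Y}) : Prop :=
  ltY' (mon_ext (fun y => monvar (nu y)) a) (mon_ext (fun y => monvar (nu y)) b).

Lemma leY_ltY a b : leY a b <-> (a = b \/ ltY a b).
Proof.
rewrite /leY le'E; split=> -[h|h]; [left|right|left|right] => //.
  exact: nu_mon_inj.
by rewrite h.
Qed.

Lemma ltY_irr a : ~ ltY a a. Proof. exact: ltY'_irr. Qed.

Lemma ltY_act rho s l m : in_Inc rho -> agrees indices_Y s rho (l ++ m) ->
  ltY (mprod l) (mprod m) ->
  ltY (mprod (map (act s) l)) (mprod (map (act s) m)).
Proof.
move=> rhoI slm; have [sl sm] := agrees_cat slm.
rewrite /ltY !mon_ext_var !(map_nu_act rhoI) //; apply: ltY'_act rhoI _.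
by rewrite -map_cat; apply: agrees_map_nu.
Qed.

Lemma leY_Inc_respecting : Inc_respecting (@all_monomials _) leY (mon_act act).
Proof.
move=> rho rhoI a b a' b' _ _; have [l ->] := mprod_surj a; have [m ->] := mprod_surj b.
have [s slm] := agrees_exists indices_Y (l ++ m) rhoI.
have [sl sm] := agrees_cat slm.
move=> /(Inc_act_mprod nominal_Y)/(_ sl) -> /(Inc_act_mprod nominal_Y)/(_ sm) ->.
move=> /leY_ltY [/mprod_eq lm|h]; apply/leY_ltY.
  by left; apply/mprod_eq/perm_map.
by right; apply: ltY_act slm h.
Qed.

Lemma nu_theta_le l : leY' (mprod (map nu (map theta_var l))) (mprod l).
Proof.
have [_ trans _ _ mul] := le'_order k.
elim: l => [|v l IH]; first by left.
rewrite /= !mprod_cons; apply: trans (mul _ _ (mprod (map nu (map theta_var l))) I I I (nu_min v)) _ => //.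
by rewrite !(mulmC (monvar v)); apply: mul.
Qed.

(** * Fibres of the monomial map *)

Section Fibres.
Context (l : nat) (phm : Y -> {cmonom varX l}).
Hypothesis phm_act : forall s y, phm (act s y) = mon_act (@actX l) s (phm y).

Local Notation G := (mon_ext phm).
Definition fibre_map := mon_ext (fun v => phm (theta_var v)).

Lemma fibre_map_theta m : fibre_map (mprod m) = G (mprod (map theta_var m)).
Proof. by rewrite /fibre_map !mon_ext_mprod big_map. Qed.

(** Since y_p is fixed by the permutations fixing 0, ..., k_p - 1, only variables
    x_(j,i) with i < k_p occur in the image of y_p.  Hence the image of
    y'_(p,alpha) is obtained from z_(p,1,alpha_1) ... by replacing each z_(p,i,b)
    with a monomial in the variables x_(j,b). *)
Lemma phm_theta_coef v (x : varX l) :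
  phm (theta_var v) x =
  \sum_p \sum_(i < k p) has_entry p i x.2 v * phm (rep p) (x.1, i : nat).
Proof.
rewrite (bigD1 (tag v)) //= [X in _ + X]big1 ?addn0; last first.
  move=> p pv; rewrite big1 // => i _.
  by rewrite /has_entry eq_sym (negbTE pv).
rewrite {1}/theta_var phm_act; have [m mE] := mprod_surj (phm (rep (tag v))).
have mk x' : x' \in m -> x'.2 < k (tag v).
  move=> x'm; apply: (@fixed_above_indices _ _ _ (nominal_X l) _ m _ x' x'.2 x'm).
    rewrite -mE => s sk; rewrite -phm_act; congr phm.
    by have [_ /(_ (tag v)) [fr _] _] := repP; apply: fr.
  by rewrite mem_head.
rewrite mE mon_act_mprod mprodE; elim: m {mE} mk => [|x' m IH] mk.
  by rewrite /= big1 // => i _; rewrite mprodE muln0.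
rewrite /= IH => [|z zm]; last by apply: mk; rewrite inE zm orbT.
under [RHS]eq_bigr => i _ do rewrite mprod_cons cmM cmU mulnDr.
rewrite big_split /=; congr addn.
have hx := mk x' (mem_head _ _).
rewrite (bigD1 (Ordinal hx)) //= big1 ?addn0 => [|i ix].
  rewrite /has_entry eqxx /= -placementP //.
  case: x' x {mk hx IH} => [j b] [j' b'] /=; rewrite /actX !xpair_eqE /= eqxx andbT.
  by case: eqP; case: eqP.
case: x' hx ix {mk IH} => [j b] /= hx; rewrite -val_eqE /= => ix.
by rewrite xpair_eqE (eq_sym b) (negbTE ix) andbF muln0.
Qed.

Lemma fibre_map_pi a b : pi_mon a = pi_mon b -> fibre_map a = fibre_map b.
Proof.
have [m ->] := mprod_surj a; have [m' ->] := mprod_surj b.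
move=> /pi_mon_eqP mm'; apply: cmonom_eqP => x.
have coefE q : fibre_map (mprod q) x =
    \sum_p \sum_(i < k p) cell p i x.2 q * phm (rep p) (x.1, i : nat).
  rewrite /fibre_map mon_ext_mprod big_mmulE.
  rewrite (eq_bigr _ (fun v _ => phm_theta_coef v x)) exchange_big /=.
  apply: eq_bigr => p _; rewrite exchange_big /=; apply: eq_bigr => i _.
  rewrite -big_distrl /=; congr muln; rewrite /cell -sum1_count [RHS]big_mkcond.
  by apply: eq_bigr => v _; case: has_entry.
by rewrite !coefE; apply: eq_bigr => p _; apply: eq_bigr => i _; rewrite mm'.
Qed.

Lemma fibre_map_act s m : fibre_map (mprod (map (act' s) m)) =
  mon_act (@actX l) s (fibre_map (mprod m)).
Proof.
rewrite /fibre_map !mon_ext_mprod big_map; elim: m => [|v m IH].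
  by rewrite !big_nil /mon_act mon_ext1.
by rewrite !big_cons IH /mon_act mon_extM theta_var_act phm_act.
Qed.

(** If a is nonminimal, then so is nu(a), which is therefore divisible by rho f for
    one of finitely many nonminimal f.  The variables of rho f are values of nu,
    so by [nu_act] those of f are as well; that is, f = nu(g) with g = theta(f), and
    rho g divides a.  A monomial smaller than f in its fibre is mapped by theta to
    a monomial smaller than g. *)
Lemma finite_nonminimal_generators : exists H : seq (seq Y * seq Y),
  (forall gh, gh \in H -> G (mprod gh.1) = G (mprod gh.2) /\
     ltY (mprod gh.2) (mprod gh.1)) /\
  forall a b, ltY b a -> G b = G a -> exists gh rho,
    [/\ gh \in H, in_Inc rho & forall s, agrees indices_Y s rho gh.1 ->
      exists c, a = mmul c (mprod (map (act s) gh.1))].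
Proof.
have [||L [LS LP]] := @nonminimal_finite_basis N k _ fibre_map _ fibre_map_pi.
- by move=> a b c h; rewrite /fibre_map !mon_extM -!/fibre_map h.
- by move=> s m m' h; rewrite !fibre_map_act h.
have ex f : exists h, f \in L -> f = map nu (map theta_var f) ->
    G (mprod (map theta_var f)) = G (mprod h) /\
    ltY (mprod h) (mprod (map theta_var f)).
  case: (boolP (f \in L)) => fL; last by exists [::].
  have [x [xf Fx]] := LS f fL; have [m xm] := mprod_surj x; subst x.
  exists (map theta_var m) => _ fE; rewrite -!fibre_map_theta Fx; split=> //.
  rewrite /ltY !mon_ext_var -fE.
  have [->//|h] := (le'E _ _).1 (nu_theta_le m).
  exact: ltY'_trans h xf.
pose hf f := sval (constructive_indefinite_description _ (ex f)).
have hfP f : f \in L -> f = map nu (map theta_var f) ->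
    G (mprod (map theta_var f)) = G (mprod (hf f)) /\
    ltY (mprod (hf f)) (mprod (map theta_var f)).
  by rewrite /hf; case: constructive_indefinite_description.
exists [seq (map theta_var f, hf f) | f <- L & f == map nu (map theta_var f)].
split=> [gh /mapP [f]|a b].
  by rewrite mem_filter => /andP[/eqP fE fL] ->; apply: hfP.
have [q ->] := mprod_surj a; have [r ->] := mprod_surj b => lt_rq Grq.
have [|f [u0 [u1 [fL qu [rho [rhoI fu]]]]]] := LP (map nu q).
  exists (mprod (map nu r)); split; first by move: lt_rq; rewrite /ltY !mon_ext_var.
  by rewrite !fibre_map_theta !mapK //; apply: nuK.
have fE : f = map nu (map theta_var f).
  have [s sf] := agrees_exists entries f rhoI.
  rewrite -map_comp -[LHS]map_id; apply/eq_in_map => v vf /=.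
  have : act' s v \in map nu q.
    by rewrite (perm_mem qu) mem_cat (fu s sf) map_f.
  case/mapP => y _ vy; apply: (act_inj act'P (s := s)).
  rewrite -(@nu_act rho) //; last by move=> b'; rewrite nu_entries; apply: sf.
  by rewrite -theta_var_act vy nuK.
exists (map theta_var f, hf f), rho; split=> //.
  by apply/mapP; exists f => //; rewrite mem_filter -fE eqxx.
move=> s /= sf; exists (mprod (map theta_var u1)).
rewrite -mprod_cat; apply/mprod_eq.
have {}sf : agrees entries s rho f.
  by move=> v b' vf bv; apply: (sf (theta_var v)); rewrite ?map_f // indices_Y_theta.
have qE := perm_map theta_var qu.
rewrite (mapK nuK) map_cat (fu s sf) in qE.
rewrite (permPl qE) perm_catC perm_cat2l -!map_comp.
by rewrite (eq_map (g := act s \o theta_var)) // => v; apply: theta_var_act.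
Qed.

End Fibres.
End Theta.

(** * Monomial maps of polynomial rings *)

Import GRing.Theory.
Local Open Scope ring_scope.

Section MonomialAlgebra.
Context (K : fieldType) (V : choiceType).
Implicit Types (f : {malg K[{cmonom V}]}) (a b : {cmonom V}).

Lemma malg_monM a b : << mmul a b >> = << a >> * << b >> :> {malg K[{cmonom V}]}.
Proof. by rewrite malgM_def fgmulUU mulr1. Qed.

Lemma malg_mon_inj a b : << a >> = << b >> :> {malg K[{cmonom V}]} -> a = b.
Proof.
move=> ab; have : (<< a >> : {malg K[{cmonom V}]})@_b = 1 by rewrite ab mcoeffUU.
rewrite mcoeffU; apply: contra_eq => /negbTE ->.
by rewrite mulr0n eq_sym oner_eq0.
Qed.

Lemma msupp_binomial a b : b != a ->
  msupp (<< a >> - << b >> : {malg K[{cmonom V}]}) = [fset a; b]%fset.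
Proof.
move=> ab; have supp1 c : msupp (<< c >> : {malg K[{cmonom V}]}) = [fset c]%fset.
  exact: msuppU1.
have disj (A B : {fset {cmonom V}}) : A = [fset a]%fset -> B = [fset b]%fset ->
    [disjoint A & B]%fset.
  by move=> -> ->; rewrite fdisjointX1 in_fset1.
exact: etrans (msuppB (disj _ _ (supp1 a) (supp1 b))) (congr2 fsetU (supp1 a) (supp1 b)).
Qed.

Lemma malg_monE f : f = \sum_(m <- msupp f) f@_m *: << m >>.
Proof.
rewrite [LHS]monalgE; apply: eq_bigr => m _; apply/malgP => m'.
by rewrite mcoeffZ [in LHS]mcoeffU [in RHS]mcoeffU mulr_natr.
Qed.

End MonomialAlgebra.

Section MonomialMap.
Context (K : fieldType) (V W : choiceType) (f : V -> {cmonom W}).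

Definition malg_mon_ext (m : {cmonom V}) : {malg K[{cmonom W}]} := << mon_ext f m >>.

Lemma malg_mon_ext_mmorphism : mmorphism malg_mon_ext.
Proof.
by split=> [a b|]; rewrite /malg_mon_ext; [rewrite mon_extM malg_monM | rewrite mon_ext1].
Qed.

HB.instance Definition _ := @isMultiplicative.Build _ _ malg_mon_ext malg_mon_ext_mmorphism.

Definition malg_map : {malg K[{cmonom V}]} -> {malg K[{cmonom W}]} :=
  mmap (@malgC {cmonom W} K) malg_mon_ext.

HB.instance Definition _ := GRing.RMorphism.on malg_map.

Lemma malg_map_scalable : scalable malg_map.
Proof. by move=> c g; rewrite /malg_map mmapZ mul_malgC. Qed.

HB.instance Definition _ := GRing.isScalable.Build K {malg K[{cmonom V}]}
  {malg K[{cmonom W}]} *:%R malg_map malg_map_scalable.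

Lemma malg_map_mon m : malg_map << m >> = << mon_ext f m >>.
Proof. by rewrite /malg_map mmapU mul1r. Qed.

End MonomialMap.

Section MonomialMapTheory.
Context (K : fieldType) (V W : choiceType).
Context (phi : {lrmorphism {malg K[{cmonom V}]} -> {malg K[{cmonom W}]}}).
Context (f : V -> {cmonom W}).
Hypothesis phiE : forall v, phi (polyvar K v) = << f v >>.

Lemma lrmorphism_mon m : phi << m >> = << mon_ext f m >>.
Proof.
have [s ->] := mprod_surj m; elim: s => [|v s IH].
  by rewrite mprod0 mon_ext1; apply: rmorph1.
have phiM a b : phi (<< a >> * << b >>) = phi << a >> * phi << b >> by apply: rmorphM.
rewrite mprod_cons mon_extM mon_extU (malg_monM K (monvar v) (mprod s)) phiM.
rewrite (malg_monM K (f v) (mon_ext f (mprod s))).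
congr (_ * _); [exact: phiE | exact: IH].
Qed.

Lemma lrmorphism_binomial a b : mon_ext f a = mon_ext f b ->
  phi (<< a >> - << b >>) = 0.
Proof.
move=> ab; have phiB x y : phi (x - y) = phi x - phi y by apply: raddfB.
apply: etrans (phiB _ _) _; apply/eqP; rewrite subr_eq0; apply/eqP.
apply: etrans (lrmorphism_mon a) _; rewrite ab.
exact: esym (lrmorphism_mon b).
Qed.

Lemma lrmorphismE g : phi g = \sum_(m <- msupp g) g@_m *: << mon_ext f m >>.
Proof.
have phiZ c a : phi (c *: a) = c *: phi a by apply: linearZ.
rewrite {1}[g]malg_monE raddf_sum; apply: eq_bigr => m _ /=.
by rewrite phiZ; congr (_ *: _); apply: lrmorphism_mon.
Qed.

Lemma mcoeff_lrmorphism g w :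
  (phi g)@_w = \sum_(m <- msupp g) g@_m *+ (mon_ext f m == w).
Proof.
rewrite lrmorphismE raddf_sum; apply: eq_bigr => m _.
by rewrite /= mcoeffZ mcoeffU mulr_natr.
Qed.

Lemma msupp_lrmorphism g w : w \in msupp (phi g) ->
  exists2 m, m \in msupp g & w = mon_ext f m.
Proof.
move=> wg; apply: NNPP => h; move: wg; rewrite -mcoeff_neq0 => /eqP; apply.
rewrite mcoeff_lrmorphism big_seq big1 // => m mg.
by case: eqP => [e|_]; [case: h; exists m | rewrite mulr0n].
Qed.

(** Otherwise the coefficient of g at m would survive in the image of g. *)
Lemma kernel_partner g m : phi g = 0 -> m \in msupp g ->
  exists m', [/\ m' \in msupp g, m' <> m & mon_ext f m' = mon_ext f m].
Proof.
move=> g0 mg; apply: NNPP => h.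
have : g@_m <> 0 by apply/eqP; rewrite mcoeff_neq0.
apply; have := mcoeff_lrmorphism g (mon_ext f m).
rewrite g0 mcoeff0 (big_fsetD1 m) //= eqxx mulr1n big_seq big1 ?addr0 => [<- //|m'].
rewrite in_fsetD1 => /andP[/eqP m'm m'g].
case: eqP => [e|_]; last by rewrite mulr0n.
by case: h; exists m'.
Qed.

End MonomialMapTheory.

Lemma malg_map_var (K : fieldType) (V W : choiceType) (f : V -> {cmonom W}) v :
  malg_map f (polyvar K v) = << f v >>.
Proof. by rewrite /polyvar malg_map_mon mon_extU. Qed.

Lemma malg_map_comp (K : fieldType) (U V W : choiceType)
    (f : V -> {cmonom W}) (g : U -> {cmonom V}) (a : {malg K[{cmonom U}]}) :
  malg_map f (malg_map g a) = malg_map (fun u => mon_ext f (g u)) a.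
Proof.
rewrite [malg_map g a](lrmorphismE (malg_map_var K g)).
rewrite [RHS](lrmorphismE (malg_map_var K _)) raddf_sum; apply: eq_bigr => m _ /=.
rewrite (@malg_map_scalable K _ _ f); congr (_ *: _).
by rewrite malg_map_mon mon_ext_comp.
Qed.

Lemma eq_malg_map (K : fieldType) (V W : choiceType) (f g : V -> {cmonom W})
    (a : {malg K[{cmonom V}]}) : f =1 g -> malg_map f a = malg_map g a.
Proof.
move=> fg; rewrite !(lrmorphismE (malg_map_var K _)); apply: eq_bigr => m _.
by rewrite (eq_mon_ext m fg).
Qed.

Lemma poly_actE (K : fieldType) (V : choiceType) (act : finperm -> V -> V) s :
  poly_act act s = malg_map (fun v => monvar (act s v)) :> ({malg K[{cmonom V}]} -> _).
Proof. by []. Qed.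

Section PolyAction.
Context (K : fieldType) (V : choiceType) (act : finperm -> V -> V).

Lemma poly_act_mon s m : poly_act act s (<< m >> : {malg K[{cmonom V}]}) = << mon_act act s m >>.
Proof. by rewrite poly_actE malg_map_mon. Qed.

Lemma poly_act_sub s (f g : {malg K[{cmonom V}]}) :
  poly_act act s (f - g) = poly_act act s f - poly_act act s g.
Proof. by rewrite poly_actE; apply: raddfB. Qed.

Lemma poly_act_binomial s a b :
  poly_act act s (<< a >> - << b >> : {malg K[{cmonom V}]}) =
  << mon_act act s a >> - << mon_act act s b >>.
Proof.
exact: etrans (poly_act_sub s _ _)
  (congr2 (fun x y => x - y) (poly_act_mon s a) (poly_act_mon s b)).
Qed.

Lemma poly_act0 s : poly_act act s (0 : {malg K[{cmonom V}]}) = 0.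
Proof. by rewrite poly_actE; apply: raddf0. Qed.

Lemma fixed_above_mon n m :
  fixed_above (mon_act act) n m -> fixed_above (poly_act act) n (<< m >> : {malg K[{cmonom V}]}).
Proof. by move=> fm s sn; rewrite poly_act_mon (fm s sn). Qed.

Lemma fixed_above_var n v :
  fixed_above (poly_act act) n (polyvar K v) -> fixed_above act n v.
Proof.
move=> fv s /fv; rewrite /polyvar poly_act_mon /mon_act mon_extU => /malg_mon_inj.
exact: monvar_inj.
Qed.

Lemma fixed_above_sub n (f g : {malg K[{cmonom V}]}) :
  fixed_above (poly_act act) n f -> fixed_above (poly_act act) n g ->
  fixed_above (poly_act act) n (f - g).
Proof. by move=> fn gn s sn; rewrite poly_act_sub fn ?gn. Qed.

Lemma malg_map_equivariant (W : choiceType) (actW : finperm -> W -> W)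
    (f : V -> {cmonom W}) :
  (forall s v, f (act s v) = mon_act actW s (f v)) ->
  equivariant (poly_act act) (poly_act actW) (malg_map (K := K) f).
Proof.
move=> fact s a; rewrite !poly_actE !malg_map_comp.
by apply: eq_malg_map => v; rewrite mon_extU fact.
Qed.

(** The polynomials whose variables lie in the orbits of the variables occurring in
    the generators form an invariant subalgebra. *)
Lemma generators_cover : is_action act ->
  Sym_finitely_generated (poly_act act : finperm -> {malg K[{cmonom V}]} -> _) ->
  exists L : seq V, forall v, exists2 x, x \in L & same_orbit act x v.
Proof.
move=> actP [F FP].
pose vars (f : {malg K[{cmonom V}]}) : seq V :=
  flatten [seq (finsupp m : seq V) | m : {cmonom V} <- enum_fset (msupp f)].
exists (flatten (map vars F)).
pose P v := exists2 x, x \in flatten (map vars F) & same_orbit act x v.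
suff h f : subalg_gen (fun g => exists2 h, h \in F & exists s, g = poly_act act s h) f ->
    forall m v, m \in msupp f -> v \in finsupp m -> P v.
  move=> v; apply: (h (polyvar K v) (FP _) (monvar v)).
    by rewrite msuppU1 in_fset1.
  by rewrite mdomU in_fset1.
elim=> {f} [c|f [g gF [s ->]]|f g _ IHf _ IHg|f g _ IHf _ IHg] m v.
- rewrite -mul_malgC mulr1 => /(fsubsetP (msuppC_le c)).
  by rewrite in_fset1 => /eqP ->; rewrite mdom1.
- rewrite poly_actE => /(msupp_lrmorphism (malg_map_var K _)) [m0 m0g ->].
  have [l lE] := mprod_surj m0; rewrite lE mon_ext_var.
  rewrite -cmE_neq0 mprodE -lt0n -has_count has_pred1 => /mapP [x xl ->].
  exists x; last by exists s.
  apply/flattenP; exists (vars g); first exact: map_f.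
  apply/flattenP; exists (enum_fset (finsupp m0)).
    exact: (map_f (fun m : {cmonom V} => enum_fset (finsupp m)) m0g).
  have : x \in finsupp m0; last by [].
  by rewrite -cmE_neq0 lE mprodE -lt0n -has_count has_pred1.
- by move=> /(fsubsetP (msuppD_le _ _)); rewrite in_fsetU => /orP[/IHf|/IHg]; apply.
move=> /msuppM_le [m1 [m2 [m1f m2g ->]]]; rewrite mdomD in_fsetU => /orP[].
  exact: IHf m1f.
exact: IHg m2g.
Qed.

End PolyAction.

(** * The Groebner basis *)

Lemma ideal_gen_sub (R : comNzRingType) (S S' : R -> Prop) f :
  (forall g, S g -> exists c g', S' g' /\ g = c * g') ->
  ideal_gen S f -> ideal_gen S' f.
Proof.
move=> SS' [n [c [g [gS ->]]]].
have ex i : exists cg : R * R, S' cg.2 /\ g i = cg.1 * cg.2.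
  by have [d [g' ?]] := SS' _ (gS i); exists (d, g').
pose d i := sval (constructive_indefinite_description _ (ex i)).
have dP i : S' (d i).2 /\ g i = (d i).1 * (d i).2.
  by rewrite /d; case: constructive_indefinite_description.
exists n, (fun i => c i * (d i).1), (fun i => (d i).2); split=> [i|].
  by case: (dP i).
by apply: eq_bigr => i _; rewrite [in LHS](dP i).2 mulrA.
Qed.

Section Main.
Context (K : fieldType) (Y : choiceType) (act : finperm -> Y -> Y).
Context (actP : is_action act).
Context (N : nat) (k : 'I_N -> nat) (rep : 'I_N -> Y).
Hypothesis repP : is_representatives k act rep.

Local Notation KY := {malg K[{cmonom Y}]}.
Local Notation thv := (@theta_var Y act N k rep).
Local Notation le := (leY actP repP).

Definition theta : {malg K[{cmonom varY' k}]} -> KY :=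
  malg_map (fun v => monvar (thv v)).

HB.instance Definition _ := GRing.LRMorphism.on theta.

Lemma theta_varE v : theta (polyvar K v) = polyvar K (thv v).
Proof. exact: malg_map_var. Qed.

Lemma leY_constructed : constructed_order K act le.
Proof.
exists N, k, rep, theta, (grevlex (@keyZ N k)), (grevlex (@keyY' N k)), (nu actP repP).
split.
- exact: repP.
- split.
  + by move=> v; exists (monvar (thv v)); apply: theta_varE.
  + apply: malg_map_equivariant => s v.
    by rewrite /mon_act mon_extU (theta_var_act actP repP).
  + move=> p; apply: etrans (theta_varE _) _.
    by rewrite (theta_var_base actP repP).
- split; first exact: grevlex_order (@keyZ_inj N k) (@size_keyZ N k) _.
  exact: grevlex_Inc_respecting (@nominal_Z N k) (@keyZ_act N k) _.
- split; first exact: grevlex_order (@keyY'_inj N k) (@size_keyY' N k) _.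
    exact: grevlex_Inc_respecting (@nominal_Y' N k) (@keyY'_act N k) _.
  exact: grevlex_reverse_lexicographic.
split=> [y|a b]; last by [].
split; first by apply: etrans (theta_varE _) _; rewrite nuK.
move=> v /(etrans (esym (theta_varE v)))/malg_mon_inj/monvar_inj <-.
exact: nu_min.
Qed.

Section Kernel.
Context (l : nat) (phi : {lrmorphism KY -> {malg K[{cmonom varX l}]}}).
Context (phm : Y -> {cmonom varX l}).
Hypothesis phiE : forall y, phi (polyvar K y) = << phm y >>.
Hypothesis phi_equivariant : equivariant (poly_act act) (poly_act (@actX l)) phi.

Lemma phm_equivariant s y : phm (act s y) = mon_act (@actX l) s (phm y).
Proof.
apply: (@malg_mon_inj K); rewrite -phiE -poly_act_mon -phiE -phi_equivariant.
by rewrite /polyvar poly_act_mon /mon_act mon_extU.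
Qed.

Lemma binomial_initial g h : ltY actP repP h g ->
  is_initial le (<< g >> - << h >> : KY) g.
Proof.
move=> hg; have gh : h != g.
  by apply/eqP => e; rewrite e in hg; apply: ltY_irr hg.
have supp_gh := @msupp_binomial K Y g h gh.
split=> [|m]; rewrite supp_gh; first exact: fset21.
rewrite in_fset2 => /orP[/eqP->|/eqP->]; apply/leY_ltY; first by left.
by right.
Qed.

(** An initial monomial m of an element of the kernel is nonminimal in its fibre,
    by [kernel_partner].  So it is divisible by rho g for one of finitely many
    nonminimal g, and rho g is the initial monomial of rho (g - h), where h is a
    smaller monomial in the fibre of g. *)
Lemma finite_Inc_groebner_basis : exists H : seq KY,
  (forall h, h \in H -> phi h = 0) /\
  Inc_groebner_basis le act (fun f => phi f = 0) (fun h => h \in H).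
Proof.
have [B [BP Bgen]] := finite_nonminimal_generators actP repP phm_equivariant.
pose bin (gh : seq Y * seq Y) : KY := << mprod gh.1 >> - << mprod gh.2 >>.
have Hker h : h \in map bin B -> phi h = 0.
  by case/mapP => gh /BP [e _] ->; apply: lrmorphism_binomial phiE _ _ e.
exists (map bin B); split=> //; split=> // f.
have nomY := nominal_Y actP repP.
split; apply: ideal_gen_sub => x [g [m [gP gm ->]]].
  exists 1, << m >>; split; last by rewrite mul1r.
  exists g, m; split=> //.
  case: gP => rho [h [rhoI /Hker h0 [n [s [_ _ ->]]]]].
  by rewrite phi_equivariant h0 poly_act0.
have [mg mmax] := gm.
have [m' [m'g m'm phm']] := kernel_partner phiE gP mg.
have lt_m'm : ltY actP repP m' m by case/leY_ltY: (mmax _ m'g).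
have [[g1 g2] [rho [gB rhoI gen]]] := Bgen _ _ lt_m'm phm'.
pose n := index_bound (indices_Y actP repP) (g2 ++ g1).
have [s sP] := finperm_of_Inc n rhoI.
have sg := agrees_index_bound sP; have [_ sg1] := agrees_cat sg.
have [c mE] := gen s sg1; rewrite /= in mE.
exists << c >>, << mprod (map (act s) g1) >>; split; last first.
  by rewrite mE malg_monM.
exists (<< mprod (map (act s) g1) >> - << mprod (map (act s) g2) >>), (mprod (map (act s) g1)).
split=> //; last first.
  apply: binomial_initial; apply: (ltY_act rhoI sg).
  by have [] := BP _ gB.
exists rho, (bin (g1, g2)); split; [exact: rhoI | exact: map_f |].
have -> : << mprod (map (act s) g1) >> - << mprod (map (act s) g2) >> =
    poly_act act s (bin (g1, g2)).
  by rewrite -!mon_act_mprod; apply: esym; apply: poly_act_binomial.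
apply: Inc_actI sP; apply: fixed_above_sub; apply: fixed_above_mon;
  apply: (fixed_above_index_bound nomY) => v b vg; apply: index_boundP;
  by rewrite mem_cat vg ?orbT.
Qed.

End Kernel.
End Main.

Theorem theorem4p1
  (K : fieldType) (Y : choiceType) (act : finperm -> Y -> Y)
  (act_action : is_action act)
  (fin_gen : Sym_finitely_generated
     (poly_act act : finperm -> {malg K[{cmonom Y}]} -> {malg K[{cmonom Y}]}))
  (fin_width : finite_width
     (poly_act act : finperm -> {malg K[{cmonom Y}]} -> {malg K[{cmonom Y}]}))
  (l : nat) (l_ge1 : (1 <= l)%N)
  (phi : {lrmorphism {malg K[{cmonom Y}]} -> {malg K[{cmonom (varX l)}]}})
  (phi_monomial : monomial_map phi)
  (phi_equivariant : equivariant (poly_act act) (poly_act (@actX l)) phi) :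
  exists le : {cmonom Y} -> {cmonom Y} -> Prop,
    [/\ constructed_order K act le,
        monomial_order (@all_monomials Y) le,
        Inc_respecting (@all_monomials Y) le (mon_act act) &
        exists H : seq {malg K[{cmonom Y}]},
          (forall h, h \in H -> phi h = 0) /\
          Inc_groebner_basis le act (fun f => phi f = 0) (fun h => h \in H)].
Proof.
have wid y : exists n, fixed_above act n y.
  by have [n /fixed_above_var yn] := fin_width (polyvar K y); exists n.
have [L Lcov] := generators_cover act_action fin_gen.
have [N [k [rep repP]]] := representatives_exist act_action wid Lcov.
pose phm y := sval (constructive_indefinite_description _ (phi_monomial y)).
have phiE y : phi (polyvar K y) = << phm y >>.
  by rewrite /phm; case: constructive_indefinite_description.
exists (leY act_action repP); split.
- exact: leY_constructed.
- exact: leY_order.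
- exact: leY_Inc_respecting.
exact: finite_Inc_groebner_basis phiE phi_equivariant.
Qed.
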